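(* Let $k$ be a field and let $p,m\ge 1$, $n\ge 0$ be integers. The reduced Gröbner basis (with respect to $\prec$) of the kernel of $\chi:k[\mathcal{C}^{np}_{p,m}]\to k[X]$ consists of the quadratic polynomials $R(\gamma^{(c)},\delta^{(d)})=\mathrm{in}_{\mathbf w}\bigl(S(\gamma^{(c)},\delta^{(d)})\bigr)$, as $\gamma^{(c)},\delta^{(d)}$ runs over the set of incomparable pairs in the poset $\mathcal{C}^{np}_{p,m}$.
   Context: $k[X]$ is the polynomial ring over $k$ in the variables $x_{i,j}^{(l)}$, $1\le i\le p$, $1\le j\le m+p$, $0\le l\le n$. $\binom{[m+p]}{p}$ is the set of sequences $\alpha=(\alpha_1<\dots<\alpha_p)$ of integers in $\{1,\dots,m+p\}$. $\mathcal{C}^{np}_{p,m}$ is the set of formal symbols $\alpha^{(a)}$ with $\alpha\in\binom{[m+p]}{p}$, $0\le a\le np$, partially ordered by $\alpha^{(a)}\le\beta^{(b)}$ iff $a\le b$ and $\alpha_i\le\beta_{b-a+i}$ for $i=1,\dots,p-b+a$; it is a distributive lattice. $k[\mathcal{C}^{np}_{p,m}]$ is the polynomial ring on these symbols, with the degree reverse lexicographic term order $\prec$ induced by a fixed (arbitrary) linear extension of the poset (for two distinct monomials of the same degree, take the smallest variable whose exponents in them differ; the monomial with the smaller exponent of that variable is the larger monomial). $\mathcal{M}(t)$ is the $p\times(m+p)$-matrix with $(i,j)$ entry $\sum_{l=0}^n x_{i,j}^{(l)}t^l$, and $\varphi:k[\mathcal{C}^{np}_{p,m}]\to k[X]$ is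 the $k$-algebra map sending $\alpha^{(a)}$ to the coefficient of $t^a$ in the maximal minor of $\mathcal{M}(t)$ with columns $\alpha_1,\dots,\alpha_p$. The reduced Gröbner basis of $\ker\varphi$ with respect to $\prec$ consists of quadratic polynomials $S(\gamma^{(c)},\delta^{(d)})$, one for each incomparable pair $\gamma^{(c)},\delta^{(d)}$ in $\mathcal{C}^{np}_{p,m}$; $S(\gamma^{(c)},\delta^{(d)})$ is the basis element with initial monomial $\gamma^{(c)}\delta^{(d)}$. $\mathcal{L}$ is the $p(n+1)\times(m+p)$-matrix whose $(i,j)$ entry is $x_{r,j}^{(l)}$, where $i=pl+r$ with $1\le r\le p$, $0\le l\le n$. The $k$-algebra map $\chi:k[\mathcal{C}^{np}_{p,m}]\to k[X]$ sends $\alpha^{(a)}$ to the minor of $\mathcal{L}$ with rows $a+1,\dots,a+p$ and columns $\alpha_1,\dots,\alpha_p$. $\mathbf w$ is the weight on the variables with $\mathbf w(\alpha^{(a)})=-a^2$, extended additively to monomials, and $\mathrm{in}_{\mathbf w}(f)$ is the sum of the terms of $f$ of maximal $\mathbf w$-weight. *)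

(* Defs.v *)
From mathcomp Require Import all_boot all_order all_algebra.
From mathcomp Require Import mpoly.
From Stdlib Require Import ClassicalEpsilon.

Set Implicit Arguments.
Unset Strict Implicit.
Unset Printing Implicit Defensive.

Import GRing.Theory Num.Theory.
Local Open Scope ring_scope.

(* Column and row indices are 0-based: 'I_(m + p) stands for {1, ..., m + p}
   and 'I_p for {1, ..., p}. *)

Definition pseq (p m : nat) : finType :=
  {s : p.-tuple 'I_(m + p) | sorted ltn [seq nat_of_ord j | j <- s]}.

Definition symb (p m n : nat) : finType := (pseq p m * 'I_(n * p).+1)%type.

Definition cols p m n (x : symb p m n) (i : 'I_p) : 'I_(m + p) :=
  tnth (sval x.1) i.

Definition symb_le p m n (x y : symb p m n) : bool :=
  (x.2 <= y.2)%N &&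
  [forall i : 'I_p, forall j : 'I_p,
     (nat_of_ord j == y.2 - x.2 + i)%N ==> (cols x i <= cols y j)%N].

Definition incomparable p m n (x y : symb p m n) : bool :=
  ~~ symb_le x y && ~~ symb_le y x.

Definition linear_extension p m n (lin : rel (symb p m n)) : Prop :=
  [/\ reflexive lin, antisymmetric lin, transitive lin, total lin
    & forall x y, symb_le x y -> lin x y].

(* Polynomials in variables indexed by a finite type T: the variable of x : T
   is the one of index enum_rank x. *)
Notation "{ 'fpoly' k [ T ] }" := {mpoly k[#|T|]}
  (at level 0, k at level 2, T at level 200, format "{ 'fpoly'  k [ T ] }").
Notation fmon T := 'X_{1.. #|T|} (only parsing).

Section GroebnerBases.
Variables (k : fieldType) (T : finType) (lin : rel T).
Implicit Types (f g h : {fpoly k[T]}) (u v : fmon T) (G : seq {fpoly k[T]}).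

Definition expo u (x : T) : nat := u (enum_rank x).

(* u < v in the degree reverse lexicographic order attached to the total
   order lin on the variables. *)
Definition drl_lt u v : bool :=
  (mdeg u < mdeg v)%N ||
  (mdeg u == mdeg v) &&
  [exists x : T, (expo v x < expo u x)%N &&
     [forall y : T, (lin y x && (y != x)) ==> (expo u y == expo v y)]].

(* The initial monomial; it is the (unhelpful) monomial 1 if f = 0. *)
Definition inmon f : fmon T :=
  head 0%MM [seq u <- msupp f
            | all (fun v => (v == u) || drl_lt v u) (msupp f)].

Definition ideal_gen (A : {fpoly k[T]} -> Prop) h : Prop :=
  exists2 s : seq ({fpoly k[T]} * {fpoly k[T]}),
    forall c, c \in s -> A c.2 & h = \sum_(c <- s) c.1 * c.2.

Definition initial_ideal (A : {fpoly k[T]} -> Prop) : {fpoly k[T]} -> Prop :=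
  ideal_gen (fun h => exists f, [/\ A f, f != 0 & h = 'X_[inmon f]]).

(* The sequence G is only considered as a finite set. *)
Definition groebner (I : {fpoly k[T]} -> Prop) G : Prop :=
  (forall g, g \in G -> I g) /\
  (forall h, initial_ideal (fun g => g \in G) h <-> initial_ideal I h).

Definition reduced_groebner (I : {fpoly k[T]} -> Prop) G : Prop :=
  [/\ groebner I G,
      forall g, g \in G -> g@_(inmon g) = 1
    & forall g h, g \in G -> h \in G -> g != h ->
        forall u, u \in msupp h -> ~~ (inmon g <= u)%MM].

End GroebnerBases.

Section Maps.
Variables (k : fieldType) (p m n : nat).

(* (i, j, l) indexes the variable x_{i,j}^{(l)}. *)
Definition xidx : finType := ('I_p * 'I_(m + p) * 'I_n.+1)%type.

Definition xvar (i : 'I_p) (j : 'I_(m + p)) (l : 'I_n.+1) : {fpoly k[xidx]} :=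
  'X_(enum_rank (i, j, l)).

Definition alg_map (F : symb p m n -> {fpoly k[xidx]})
    (f : {fpoly k[symb p m n]}) : {fpoly k[xidx]} :=
  mmap (@mpolyC _ k) (fun i => F (enum_val i)) f.

Definition Mt : 'M[{poly {fpoly k[xidx]}}]_(p, m + p) :=
  \matrix_(i, j) \sum_(l < n.+1) (xvar i j l)%:P * 'X^l.

Definition phi : {fpoly k[symb p m n]} -> {fpoly k[xidx]} :=
  alg_map (fun x => (\det (colsub (cols x) Mt))`_(x.2)).

Fact Lrow_mod (i : 'I_(p * n.+1)) : (i %% p < p)%N.
Proof. by case: p i => [|q] [i ltip] /=; rewrite ?ltn_mod. Qed.

Fact Lrow_div (i : 'I_(p * n.+1)) : (i %/ p < n.+1)%N.
Proof.
by case: p i => [|q] [i ltip] /=; rewrite ?ltn_divLR 1?mulnC.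
Qed.

Definition Lmx : 'M[{fpoly k[xidx]}]_(p * n.+1, m + p) :=
  \matrix_(i, j) xvar (Ordinal (Lrow_mod i)) j (Ordinal (Lrow_div i)).

Fact Lrow_shift (a : 'I_(n * p).+1) (i : 'I_p) : (a + i < p * n.+1)%N.
Proof.
case: a i => [a lta] [i lti] /=.
by rewrite mulnS [(p * n)%N]mulnC addnC -addSn leq_add.
Qed.

Definition Lrow (a : 'I_(n * p).+1) (i : 'I_p) : 'I_(p * n.+1) :=
  Ordinal (Lrow_shift a i).

Definition chi : {fpoly k[symb p m n]} -> {fpoly k[xidx]} :=
  alg_map (fun x => \det (mxsub (Lrow x.2) (cols x) Lmx)).

Definition weight (u : fmon (symb p m n)) : int :=
  \sum_(x : symb p m n) (- ((x.2 : nat)%:Z ^+ 2)) *+ expo u x.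

Definition in_w (f : {fpoly k[symb p m n]}) : {fpoly k[symb p m n]} :=
  \sum_(u <- msupp f | all (fun v => weight v <= weight u) (msupp f))
     f@_u *: 'X_[u].

Definition ker_phi (f : {fpoly k[symb p m n]}) : Prop := phi f = 0.
Definition ker_chi (f : {fpoly k[symb p m n]}) : Prop := chi f = 0.

Variable lin : rel (symb p m n).

(* The element with initial monomial x * y of the reduced Groebner basis of
   ker phi. The description operator has an unspecified value when there is no
   such element. *)
Definition Spol (x y : symb p m n) : {fpoly k[symb p m n]} :=
  epsilon (inhabits 0) (fun f =>
    exists2 G, reduced_groebner lin ker_phi G &
      f \in G /\ inmon lin f = (U_(enum_rank x) + U_(enum_rank y))%MM).

Definition Rpol (x y : symb p m n) : {fpoly k[symb p m n]} :=
  in_w (Spol x y).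

End Maps.

(* Main.v *)
Require Import Defs.
From mathcomp Require Import all_boot all_order all_algebra all_fingroup.
From mathcomp Require Import mpoly.
From mathcomp Require Import zify ring.
From Stdlib Require Import ClassicalEpsilon.

Set Implicit Arguments.
Unset Strict Implicit.
Unset Printing Implicit Defensive.

Import Order.TTheory GRing.Theory Num.Theory.
Local Open Scope ring_scope.

(** A monomial in the symbols is standard when its variables form a chain.  The
    other monomials are the multiples of the incomparable pairs, so a
    set of relations g(x, y), one for each incomparable pair, is a reduced
    Groebner basis of a kernel as soon as (1) g(x, y) is x * y minus standard
    monomials smaller than x * y in the term order, and (2) no nonzero element
    of the kernel is a combination of standard monomials
    ([reduced_groebner_standard]).  Both kernels are treated in this way.

    For (2), to a symbol x = alpha^(a) one attaches its level function
    s |-> a + #{i | alpha_i >= s}.  The order of the poset is the pointwise order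
    of level functions ([symb_le_level]).  For every s, moving the columns of
    index at least s down by p rows turns the antidiagonal of the minor of x into
    p consecutive rows starting at the level of x at s, and turns every other
    term of the minor, or of the coefficient of t^a in the minor of M(t), into
    another system of representatives of the residues modulo p with the same sum.
    A convex function of the rows, summed over the entries of a term, is therefore
    minimal at the antidiagonal.  The squares, for all s together, isolate the
    antidiagonal: it is an initial monomial of both phi(x) and chi(x).  The
    functions max(0, z - row) show that a chain can be read off the product of
    its antidiagonals ([standard_inj]).  Initial monomials of distinct standard
    monomials are thus distinct, which gives (2) ([kernel_nonstandard]).

    For (1) and phi, let x = gamma^(c) and y = delta^(d) be incomparable, with
    c <= d.  Exchanging p + 1 + d - c columns between the minors of M(t) and M(s)
    gives a determinant that is divisible by (t - s)^(d-c+1) ([det_exchange]).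
    Divisibility yields a linear relation between its coefficients in which,
    among the bidegrees from (c, d) to (d, c), only (c, d) occurs
    ([annihilator]); the remaining terms have degrees farther apart than c and d,
    or have the degrees c and d and a first factor with smaller columns.
    Induction writes phi(x) phi(y) as a combination of products of comparable
    pairs ([straightening]).  The weight that adds a large multiple of
    max(0, z - row) then forces each comparable pair a <= b in this expression to
    satisfy a <= x and a <= y ([plucker_relation_exists]), hence to be
    smaller than x * y for every linear extension.

    For (1) and chi, the squares of the rows, without shifts, have as initial form
    of phi(x) the minor chi(x) up to a sign of the form kappa^a, where a is the
    degree of x.  So the terms of maximal weight of S(x, y) form an element of the kernel
    of chi ([in_w_plucker]).  It contains x * y, since it would otherwise be a
    nonzero combination of standard monomials in that kernel. *)

(** * The term order and reduced Groebner bases of standard complements *)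

Section TermOrder.
Variables (T : finType) (lin : rel T).
Hypotheses (lin_anti : antisymmetric lin)
  (lin_trans : transitive lin) (lin_total : total lin).
Implicit Types u v w : fmon T.

Lemma lin_refl : reflexive lin.
Proof. by move=> x; have := lin_total x x; rewrite orbb. Qed.

Lemma lin_least (P : pred T) x0 : P x0 ->
  exists2 x, P x & forall y, P y -> lin x y.
Proof.
move=> Px0; case: (arg_minnP (fun x => #|[pred y | lin y x]|) Px0) => x Px minx.
exists x => // y Py; have /orP[//|yx] := lin_total x y.
case: (eqVneq x y) => [->|neq]; first exact: lin_refl.
have := minx y Py; rewrite leqNgt => /negP[]; apply: proper_card.
apply/properP; split.
  by apply/subsetP=> z; rewrite !inE => /lin_trans; apply.
exists x; rewrite !inE ?lin_refl //; apply/negP=> xy.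
by move: neq; rewrite (lin_anti (introT andP (conj xy yx))) eqxx.
Qed.

Lemma expo_inj u v : (forall x : T, expo u x = expo v x) -> u = v.
Proof.
move=> e; apply/mnmP=> i; have := e (enum_val i).
by rewrite /expo enum_valK.
Qed.

Lemma expoD u v (x : T) : expo (u + v)%MM x = (expo u x + expo v x)%N.
Proof. exact: mnmDE. Qed.

Lemma expoU (x y : T) : expo (U_(enum_rank x))%MM y = (x == y).
Proof. by rewrite /expo mnm1E (inj_eq enum_rank_inj). Qed.

Lemma drl_ltP u v : reflect
  ((mdeg u < mdeg v)%N \/ mdeg u = mdeg v /\ exists2 x, (expo v x < expo u x)%N &
     forall y, lin y x -> y != x -> expo u y = expo v y)
  (drl_lt lin u v).
Proof.
apply: (iffP orP) => [[|/andP[/eqP d /existsP[x /andP[ltx /forallP h]]]]|].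
- by left.
- right; split=> //; exists x => // y yx nyx.
  by have := h y; rewrite yx nyx => /eqP.
case=> [|[d [x ltx h]]]; [by left | right].
rewrite d eqxx; apply/existsP; exists x; rewrite ltx.
by apply/forallP=> y; apply/implyP=> /andP[yx nyx]; rewrite h.
Qed.

Lemma drl_lt_mdeg u v : drl_lt lin u v -> (mdeg u <= mdeg v)%N.
Proof. by case/drl_ltP=> [/ltnW|[-> _]]. Qed.

Lemma drl_lt_irr u : drl_lt lin u u = false.
Proof. by apply/negP=> /drl_ltP; rewrite ltnn => -[//|[_ [x]]]; rewrite ltnn. Qed.

Lemma drl_lt_trans v u w : drl_lt lin u v -> drl_lt lin v w -> drl_lt lin u w.
Proof.
move=> /drl_ltP uv /drl_ltP vw; apply/drl_ltP.
case: uv => [uv|[duv [x ltx hx]]]; case: vw => [vw|[dvw [y lty hy]]].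
- by left; apply: ltn_trans uv vw.
- by left; rewrite -dvw.
- by left; rewrite duv.
right; split; first by rewrite duv.
have eqv a b : lin a b -> lin b a -> a = b by move=> h1 h2; apply: lin_anti; rewrite h1.
case: (eqVneq x y) => [exy|nxy].
  exists x => [|z zx nzx]; first by rewrite exy in ltx *; apply: ltn_trans ltx.
  by rewrite hx // hy // -exy.
have /orP[xy|yx] := lin_total x y.
  exists x => [|z zx nzx]; first by rewrite -(hy x).
  rewrite hx // hy //; first exact: lin_trans zx xy.
  by apply: contraNneq nxy => ezy; rewrite (eqv x y) // -ezy.
exists y => [|z zy nzy]; first by rewrite (hx y) // eq_sym.
rewrite hx ?hy //; first exact: lin_trans zy yx.
by apply: contraNneq nxy => ezx; rewrite (eqv x y) // -ezx.
Qed.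

Lemma drl_lt_total u v : u != v -> drl_lt lin u v || drl_lt lin v u.
Proof.
move=> nuv; case: (ltngtP (mdeg u) (mdeg v)) => d.
- by apply/orP; left; apply/drl_ltP; left.
- by apply/orP; right; apply/drl_ltP; left.
have [x0 Px0] : exists x : T, expo u x != expo v x.
  apply/existsP; rewrite -negb_forall; apply: contra nuv => /forallP h.
  by apply/eqP/expo_inj => x; apply/eqP/h.
have [x Px minx] := @lin_least [pred x | expo u x != expo v x] x0 Px0.
have same y : lin y x -> y != x -> expo u y = expo v y.
  move=> yx nyx; apply/eqP/idPn=> /minx xy.
  by move: nyx; rewrite (lin_anti (introT andP (conj xy yx))) eqxx.
move: Px; rewrite inE neq_ltn => /orP[lt|lt]; apply/orP; [right|left];
  apply/drl_ltP; right; split=> //; exists x => // y yx nyx.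
by rewrite same.
Qed.

Lemma drl_ltD u v w : drl_lt lin u v -> drl_lt lin (w + u)%MM (w + v)%MM.
Proof.
case/drl_ltP=> [lt|[d [x ltx hx]]]; apply/drl_ltP; rewrite !mdegD.
  by left; rewrite ltn_add2l.
right; split; first by rewrite d.
by exists x => [|y yx nyx]; rewrite !expoD ?ltn_add2l // hx.
Qed.

Lemma lepm_mdeg_eq u v : (u <= v)%MM -> (mdeg v <= mdeg u)%N -> u = v.
Proof.
move=> /submK <-; rewrite mdegD -{2}[mdeg u]add0n leq_add2r leqn0 mdeg_eq0.
by move/eqP->; rewrite add0m.
Qed.

(** The order refines divisibility, because it compares degrees first. *)
Lemma lepm_drl_ltN u v : (u <= v)%MM -> drl_lt lin v u -> False.
Proof.
move=> le lt; have := lepm_mdeg_eq le (drl_lt_mdeg lt) => e.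
by rewrite e drl_lt_irr in lt.
Qed.

Variable k : fieldType.
Implicit Types f g : {fpoly k[T]}.

Lemma inmon_eq f u : u \in msupp f ->
  (forall v, v \in msupp f -> v != u -> drl_lt lin v u) -> inmon lin f = u.
Proof.
move=> uf hu; rewrite /inmon; set s := [seq _ <- _ | _].
have us : u \in s.
  rewrite mem_filter uf andbT; apply/allP=> v vf.
  by case: eqVneq => //= nvu; apply: hu.
have: all (pred1 u) s.
  apply/allP=> v; rewrite mem_filter => /andP[/allP hv vf] /=.
  case: (eqVneq v u) => // nvu; have := hu _ vf nvu.
  have := hv _ uf; rewrite eq_sym (negPf nvu) /= => l1 l2.
  by have := drl_lt_trans l1 l2; rewrite drl_lt_irr.
by case: s us => //= v s _ /andP[/eqP].
Qed.

Lemma inmonP f : f != 0 -> inmon lin f \in msupp f /\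
  forall v, v \in msupp f -> v != inmon lin f -> drl_lt lin v (inmon lin f).
Proof.
rewrite -msupp_eq0 => nf.
have [u us hu] : exists2 u, u \in msupp f &
    forall v, v \in msupp f -> v != u -> drl_lt lin v u.
  elim: (msupp f) nf => // a s IH _; case: (eqVneq s [::]) => [->|/IH].
    by exists a => [|v]; rewrite inE // => ->.
  case=> u us hu; case: (eqVneq a u) => [->|nau].
    exists u; first by rewrite inE eqxx.
    by move=> v; rewrite inE => /predU1P[->|/hu//]; rewrite eqxx.
  have /orP[lau|lua] := drl_lt_total nau.
    exists u; first by rewrite inE us orbT.
    by move=> v; rewrite inE => /predU1P[->//|/hu].
  exists a; first by rewrite inE eqxx.
  move=> v; rewrite inE => /predU1P[->|vs _]; first by rewrite eqxx.
  by case: (eqVneq v u) => [->//|/(hu _ vs)/drl_lt_trans]; apply.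
by rewrite (inmon_eq us hu).
Qed.

(** A monomial of an ideal generated by monomials is a multiple of a generator:
    it occurs in one of the products of which it is the sum. *)
Lemma monomial_ideal (A : {fpoly k[T]} -> Prop) u :
  ideal_gen (fun h : {fpoly k[T]} => exists f, [/\ A f, f != 0 & h = 'X_[inmon lin f]]) 'X_[u] ->
  exists f, [/\ A f, f != 0 & (inmon lin f <= u)%MM].
Proof.
case=> s hs e.
have: u \in msupp (\sum_(c <- s) c.1 * c.2) by rewrite -e msuppX inE.
move/msupp_sum_le => /flatten_mapP[c]; rewrite filter_predT => cs.
case: (hs c cs) => f [Af nf ->]; rewrite (perm_mem (msuppMX _ _)).
by case/mapP=> v _ ->; exists f; split=> //; rewrite lem_addr.
Qed.

Lemma ideal_gen_le (A : {fpoly k[T]} -> Prop) f u :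
  A f -> f != 0 -> (inmon lin f <= u)%MM ->
  ideal_gen (fun h : {fpoly k[T]} => exists f, [/\ A f, f != 0 & h = 'X_[inmon lin f]]) 'X_[u].
Proof.
move=> Af nf le; exists [:: ('X_[u - inmon lin f], 'X_[inmon lin f])].
  by move=> c; rewrite inE => /eqP ->; exists f.
by rewrite big_seq1 /= -mpolyXD submK.
Qed.

Variables (B : rel T) (I : {fpoly k[T]} -> Prop).
Variable S : T -> T -> {fpoly k[T]}.

Local Notation pair x y := (U_(enum_rank x) + U_(enum_rank y))%MM.

Definition standard u := [forall x, forall y, B x y ==> ~~ (pair x y <= u)%MM].

Lemma standardP u : reflect (forall x y, B x y -> ~~ (pair x y <= u)%MM) (standard u).
Proof.
apply: (iffP forallP) => [h x y|h x].
  by move/forallP/(_ y)/implyP: (h x).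
by apply/forallP=> y; apply/implyP=> /h.
Qed.

Lemma nstandardP u : reflect (exists x y, B x y /\ (pair x y <= u)%MM) (~~ standard u).
Proof.
rewrite negb_forall; apply: (iffP existsP) => [[x]|[x [y [Bxy le]]]].
  rewrite negb_forall => /existsP[y]; rewrite negb_imply negbK => /andP[Bxy le].
  by exists x, y.
by exists x; rewrite negb_forall; apply/existsP; exists y; rewrite Bxy le.
Qed.

Hypotheses (I0 : I 0) (ID : forall f g, I f -> I g -> I (f + g))
  (IM : forall f g, I g -> I (f * g)).
Hypothesis S_in : forall x y, B x y -> I (S x y).
Hypothesis S_lead : forall x y, B x y -> (S x y)@_(pair x y) = 1.
Hypothesis S_tail : forall x y u, B x y -> u \in msupp (S x y) ->
  u != pair x y -> standard u /\ drl_lt lin u (pair x y).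
Hypothesis I_standard : forall f, I f ->
  (forall u, u \in msupp f -> standard u) -> f = 0.

Lemma ideal_opp f : I f -> I (- f).
Proof. by rewrite -mulN1r; apply: IM. Qed.

Lemma S_supp x y : B x y -> pair x y \in msupp (S x y).
Proof. by move=> Bxy; rewrite mcoeff_msupp S_lead ?oner_eq0. Qed.

Lemma S_neq0 x y : B x y -> S x y != 0.
Proof. by move/S_supp; apply: contraTneq => ->; rewrite msupp0. Qed.

Lemma S_inmon x y : B x y -> inmon lin (S x y) = pair x y.
Proof.
move=> Bxy; apply: inmon_eq; first exact: S_supp.
by move=> v vS nv; have [] := S_tail Bxy vS nv.
Qed.

Let nf v g := I ('X_[v] - g) /\
  forall w, w \in msupp g -> standard w /\ (w = v \/ drl_lt lin w v).

Lemma normal_form_sum (s : seq (fmon T)) (c : fmon T -> k) :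
  (forall v, v \in s -> exists g, nf v g) ->
  exists g, I (\sum_(v <- s) c v *: 'X_[v] - g) /\
    forall w, w \in msupp g -> standard w /\
      exists2 v, v \in s & (w = v \/ drl_lt lin w v).
Proof.
elim: s => [|a s IH] hs.
  by exists 0; rewrite big_nil subr0; split=> // w; rewrite msupp0.
have [|g [Ig hg]] := IH; first by move=> v vs; apply: hs; rewrite inE vs orbT.
have [g1 [Ig1 hg1]] := hs a (mem_head a s).
exists (c a *: g1 + g); split.
  rewrite big_cons opprD addrACA -scalerBr; apply: ID => //.
  by rewrite -mul_mpolyC; apply: IM.
move=> w /msuppD_le; rewrite mem_cat => /orP[/msuppZ_le/hg1[sw lw]|/hg[sw [v vs lw]]].
  by split=> //; exists a => //; rewrite mem_head.
by split=> //; exists v => //; rewrite inE vs orbT.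
Qed.

(** Division by the relations: a multiple of a pair is replaced by smaller
    monomials, of which there are finitely many because degrees do not grow. *)
Lemma normal_form_mon u : exists g, nf u g.
Proof.
have [D ltD] : exists D, (mdeg u < D)%N by exists (mdeg u).+1.
have [N] := ubnP #|[set v : 'X_{1..#|T| < D} | drl_lt lin v u]|.
elim: N u ltD => // N IH u ltD leN.
have [su|/nstandardP[x [y [Bxy le]]]] := boolP (standard u).
  exists 'X_[u]; rewrite /nf subrr; split=> // w.
  by rewrite msuppX inE => /eqP ->; split=> //; left.
pose w := (u - pair x y)%MM.
have eu : u = (w + pair x y)%MM by rewrite /w submK.
pose f := 'X_[w] * S x y.
have ef : f = \sum_(v <- msupp (S x y)) (S x y)@_v *: 'X_[w + v].
  rewrite /f {1}[S x y]mpolyE mulr_sumr; apply: eq_bigr => v _.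
  by rewrite -scalerAr mpolyXD.
have key : 'X_[u] - f = \sum_(v <- [seq (w + v)%MM | v <- msupp (S x y) & v != pair x y])
     (- (S x y)@_(v - w)) *: 'X_[v].
  rewrite ef [RHS]big_map [RHS]big_filter (bigD1_seq (pair x y)) ?S_supp ?msupp_uniq //=.
  rewrite S_lead // scale1r -eu opprD addrA subrr add0r -sumrN.
  by apply: eq_bigr => v _; rewrite scaleNr addmC addmK.
have [|g [Ig hg]] := @normal_form_sum
    [seq (w + v)%MM | v <- msupp (S x y) & v != pair x y] (fun v => - (S x y)@_(v - w)).
  move=> v /mapP[v0]; rewrite mem_filter => /andP[nv0 v0S] ->.
  have [_ /(@drl_ltD _ _ w)] := S_tail Bxy v0S nv0; rewrite -eu => lt.
  have ltD' : (mdeg (w + v0)%MM < D)%N by apply: leq_ltn_trans ltD; apply: drl_lt_mdeg.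
  apply: IH (ltD') _; rewrite -ltnS; apply: leq_trans leN; rewrite ltnS.
  apply: proper_card; apply/properP; split.
    by apply/subsetP=> z; rewrite !inE => /drl_lt_trans; apply.
  by exists (BMultinom ltD'); rewrite !inE //= drl_lt_irr.
exists g; split.
  have -> : 'X_[u] - g = ('X_[u] - f - g) + f by rewrite addrAC subrK.
  by apply: ID; [rewrite key | rewrite /f; apply: IM; apply: S_in].
move=> z /hg[sz [v /mapP[v0]]]; rewrite mem_filter => /andP[nv0 v0S] ->.
have [_ /(@drl_ltD _ _ w)] := S_tail Bxy v0S nv0; rewrite -eu => lt lz.
by split=> //; right; case: lz => [->//|/drl_lt_trans]; apply.
Qed.

(** Reducing the tail of an element with standard initial monomial would leave a
    nonzero combination of standard monomials in the ideal. *)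
Lemma inmon_nstandard f : I f -> f != 0 -> ~~ standard (inmon lin f).
Proof.
move=> If nf0; apply/negP=> su; have [uf hu] := inmonP nf0.
set u := inmon lin f in su uf hu.
have [|g [Ig hg]] := @normal_form_sum [seq v <- msupp f | v != u] (fun v => f@_v).
  by move=> v _; apply: normal_form_mon.
set h := \sum_(v <- _) _ in Ig.
have ef : f = f@_u *: 'X_[u] + h.
  by rewrite {1}[f]mpolyE (bigD1_seq u) ?msupp_uniq //= /h big_filter.
have gu : g@_u = 0.
  apply/eqP; rewrite mcoeff_eq0; apply/negP=> /hg[_ [v]].
  rewrite mem_filter => /andP[nvu vf] ev; have := hu _ vf nvu.
  case: ev => [->|lt1 lt2]; first by rewrite drl_lt_irr.
  by have := drl_lt_trans lt1 lt2; rewrite drl_lt_irr.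
have: f@_u *: 'X_[u] + g = 0.
  apply: I_standard.
    have -> : f@_u *: 'X_[u] + g = f + - (h - g).
      by rewrite {2}ef; move: (f@_u *: _) => a; rewrite opprB -addrA subrKC.
    by apply: ID => //; apply: ideal_opp.
  move=> w /msuppD_le; rewrite mem_cat => /orP[/msuppZ_le|/hg[]//].
  by rewrite msuppX inE => /eqP ->.
move/(congr1 (mcoeff u)); rewrite mcoeffD mcoeffZ mcoeffX eqxx mulr1 gu addr0.
by rewrite mcoeff0 => /eqP; rewrite mcoeff_eq0 uf.
Qed.

Lemma monic_standard_eq f g u : I f -> I g -> f@_u = 1 -> g@_u = 1 ->
  (forall v, v \in msupp f -> v != u -> standard v) ->
  (forall v, v \in msupp g -> v != u -> standard v) -> f = g.
Proof.
move=> If Ig fu gu hf hg; apply/eqP; rewrite -subr_eq0; apply/eqP/I_standard.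
  by apply: ID => //; apply: ideal_opp.
move=> v vfg; have nvu : v != u.
  by apply: contraTneq vfg => ->; rewrite mcoeff_msupp mcoeffB fu gu subrr eqxx.
by move/msuppB_le: vfg; rewrite mem_cat => /orP[/hf|/hg]; apply.
Qed.

Lemma ideal_gen_sum (A : {fpoly k[T]} -> Prop) (s : seq ({fpoly k[T]} * {fpoly k[T]})) :
  (forall c, c \in s -> ideal_gen A c.2) -> ideal_gen A (\sum_(c <- s) c.1 * c.2).
Proof.
elim: s => [|c s IH] hs; first by exists [::] => //; rewrite !big_nil.
have [|s1 h1 e1] := IH; first by move=> d ds; apply: hs; rewrite inE ds orbT.
have [s2 h2 e2] := hs c (mem_head c s).
exists ([seq (c.1 * d.1, d.2) | d <- s2] ++ s1).
  by move=> d; rewrite mem_cat => /orP[/mapP[d' /h2 h ->]//|/h1].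
rewrite big_cons e1 big_cat big_map e2 mulr_sumr; congr (_ + _).
by apply: eq_bigr => d _; rewrite mulrA.
Qed.

(** The criterion by which both kernels are handled: quadratic relations with
    standard tails generate the initial ideal once standard monomials are
    independent modulo I, and then the basis is automatically reduced. *)
Lemma reduced_groebner_standard :
  reduced_groebner lin I [seq S x.1 x.2 | x : T * T in [pred x | B x.1 x.2]].
Proof.
set G := [seq _ | _ : _ in _].
have GP g : g \in G -> exists x y, B x y /\ g = S x y.
  by case/imageP=> -[x y] /= Bxy ->; exists x, y.
have GI x y : B x y -> S x y \in G by move=> Bxy; apply/imageP; exists (x, y).
split.
- split; first by move=> g /GP[x [y [Bxy ->]]]; apply: S_in.
  move=> h; split=> -[s hs ->].
    exists s => // c /hs[f [Af nf0 ->]].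
    by exists f; split=> //; have [x [y [Bxy ->]]] := GP _ Af; apply: S_in.
  apply: ideal_gen_sum => c /hs[f [If nf0 ->]].
  have /nstandardP[x [y [Bxy le]]] := inmon_nstandard If nf0.
  by apply: (ideal_gen_le (GI x y Bxy)); rewrite ?S_neq0 ?S_inmon.
- by move=> g /GP[x [y [Bxy ->]]]; rewrite S_inmon // S_lead.
move=> g h /GP[x [y [Bxy ->]]] /GP[x' [y' [Bxy' ->]]] neq u uS.
rewrite S_inmon //; case: (eqVneq u (pair x' y')) => [eu|nu]; last first.
  by have [/standardP/(_ _ _ Bxy)] := S_tail Bxy' uS nu.
apply/negP=> le; move: neq; rewrite eu in le.
have e : pair x y = pair x' y' by apply: lepm_mdeg_eq => //; rewrite !mdegD !mdeg1.
have e1 := S_lead Bxy; rewrite e in e1.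
rewrite (monic_standard_eq (S_in Bxy) (S_in Bxy') e1 (S_lead Bxy')) ?eqxx //.
  by move=> v vS nv; rewrite -e in nv; have [] := S_tail Bxy vS nv.
by move=> v vS nv; have [] := S_tail Bxy' vS nv.
Qed.

(** By minimality the tail of an element of a reduced basis is standard, and two
    elements of I that are monic with the same initial monomial and standard tails
    differ by a combination of standard monomials, which is 0. *)
Lemma reduced_groebner_unique G f x y :
  reduced_groebner lin I G -> f \in G -> B x y ->
  inmon lin f = pair x y -> f = S x y.
Proof.
case=> -[GI Gin] Gmonic Gred fG Bxy ef.
have f1 := Gmonic f fG; rewrite ef in f1.
apply: (monic_standard_eq (GI f fG) (S_in Bxy) f1 (S_lead Bxy)); last first.
  by move=> v vS nv; have [] := S_tail Bxy vS nv.
move=> v vf nv; apply/idPn=> /nstandardP[x' [y' [Bxy' le]]].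
have nf0 : f != 0 by apply: contraTneq vf => ->; rewrite msupp0.
have: initial_ideal lin I 'X_[v].
  by apply: (ideal_gen_le (S_in Bxy')); rewrite ?S_neq0 ?S_inmon.
rewrite -Gin => /monomial_ideal[g [gG ng gle]].
case: (eqVneq g f) => [egf|ngf]; last by have := Gred _ _ gG fG ngf v vf; rewrite gle.
rewrite egf in gle; apply: (lepm_drl_ltN gle).
by have [_ h] := inmonP nf0; apply: h; rewrite ?ef.
Qed.

End TermOrder.

(** * Level functions of symbols *)

Section Level.
Variables p m n : nat.
Implicit Types x y : symb p m n.

(** This is the row of the antidiagonal of x at which the columns of index at
    least s have all been passed; the poset embeds in functions of s. *)
Definition level x (s : nat) : nat := (x.2 + \sum_(i < p) (s <= cols x i))%N.

Lemma ltn_cols x (i j : 'I_p) : (i < j)%N -> (cols x i < cols x j)%N.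
Proof.
move=> ij; have := svalP x.1; rewrite /cols.
set t := sval x.1 => st.
have tr : transitive ltn by move=> a b c; apply: ltn_trans.
have := sorted_ltn_nth tr 0%N st; rewrite size_map size_tuple.
move/(_ i j (ltn_ord i) (ltn_ord j) ij).
by rewrite !(nth_map (cols x i)) ?size_tuple // -!tnth_nth.
Qed.

Lemma leq_cols x (i j : 'I_p) : (i <= j)%N -> (cols x i <= cols x j)%N.
Proof. by rewrite leq_eqVlt => /predU1P[/val_inj->//|/ltn_cols/ltnW]. Qed.

Lemma sum_ord_ge (q b : nat) : (\sum_(i < q) (b <= i) = q - b)%N.
Proof.
elim: q => [|q IH]; first by rewrite big_ord0.
by rewrite big_ord_recr /= IH; lia.
Qed.

(** The columns that are at least s are the last ones, so that their number says
    which they are. *)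
Lemma leq_cols_count x s (i : 'I_p) :
  (s <= cols x i)%N = (p - i <= \sum_(j < p) (s <= cols x j))%N.
Proof.
apply/idP/idP => [le|].
  rewrite -sum_ord_ge; apply: leq_sum => j _.
  by case: (leqP i j) => // ij; rewrite (leq_trans le) ?leq_cols.
apply: contraLR; rewrite -!ltnNge => lt.
apply: (@leq_ltn_trans (\sum_(j < p) (i.+1 <= j))%N); last first.
  by rewrite sum_ord_ge; have := ltn_ord i; lia.
apply: leq_sum => j _; case: (ltnP i j) => [_|ji]; first exact: leq_b1.
by rewrite (leqNgt s) (leq_ltn_trans _ lt) ?leq_cols.
Qed.

Lemma count_cols x (i : 'I_p) : (\sum_(j < p) (cols x i <= cols x j) = p - i)%N.
Proof.
rewrite -sum_ord_ge; apply: eq_bigr => j _; congr nat_of_bool.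
by apply/idP/idP => [|/leq_cols//]; apply: contraLR; rewrite -!ltnNge; apply: ltn_cols.
Qed.

Lemma count_colsS x (i : 'I_p) : (\sum_(j < p) (cols x i < cols x j) = p - i.+1)%N.
Proof.
rewrite -sum_ord_ge; apply: eq_bigr => j _; congr nat_of_bool.
by apply/idP/idP => [|/ltn_cols//]; apply: contraLR; rewrite -!leqNgt; apply: leq_cols.
Qed.

Lemma level_end x : level x (m + p) = x.2.
Proof.
rewrite /level big1 ?addn0 // => i _.
by rewrite leqNgt ltn_ord.
Qed.

(** The condition alpha_i <= beta_(b-a+i) says, in terms of counting functions,
    that beta loses at most b - a of the columns of alpha beyond any s. *)
Lemma symb_le_level x y : reflect (forall s, level x s <= level y s)%N (symb_le x y).
Proof.
apply: (iffP andP) => [[le /forallP h] s|h].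
  rewrite /level; set c := (\sum_(i < p) _)%N; set d := (\sum_(i < p) _)%N.
  case: (leqP c (y.2 - x.2)) => [|lt]; first by lia.
  have cp : (c <= p)%N.
    by rewrite -[X in (_ <= X)%N]subn0 -sum_ord_ge; apply: leq_sum => i _; exact: leq_b1.
  have ip : (p - c < p)%N by lia.
  have jp : (y.2 - x.2 + (p - c) < p)%N by lia.
  have := h (Ordinal ip) => /forallP/(_ (Ordinal jp)); rewrite eqxx /= => lxy.
  have : (s <= cols x (Ordinal ip))%N by rewrite leq_cols_count /= -/c; lia.
  move/leq_trans=> /(_ _ lxy); rewrite leq_cols_count /= -/d.
  clearbody c d; move: le lt cp; clear.
  move: (nat_of_ord x.2) (nat_of_ord y.2) => a b; lia.
have le : (x.2 <= y.2)%N by have := h (m + p)%N; rewrite !level_end.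
split=> //; apply/forallP=> i; apply/forallP=> j; apply/implyP=> /eqP ej.
rewrite leq_cols_count; have := h (cols x i); rewrite /level count_cols.
have := ltn_ord j; have := ltn_ord i; lia.
Qed.

Lemma level_inj x y : (forall s, level x s = level y s) -> x = y.
Proof.
move=> h; have e2 : x.2 = y.2 by apply: val_inj; have := h (m + p)%N; rewrite !level_end.
have hc i : cols x i = cols y i.
  have c s : (\sum_(j < p) (s <= cols x j) = \sum_(j < p) (s <= cols y j))%N.
    by have := h s; rewrite /level e2 => /addnI.
  have cc s : (s <= cols x i)%N = (s <= cols y i)%N by rewrite !leq_cols_count c.
  by apply/val_inj/anti_leq; rewrite cc leqnn -cc leqnn.
case: x y e2 hc {h} => [x1 x2] [y1 y2] /= -> hc; congr pair.
by apply/val_inj/eq_from_tnth => i; apply: hc.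
Qed.

Lemma symb_le_refl : reflexive (@symb_le p m n).
Proof. by move=> x; apply/symb_le_level. Qed.

End Level.

(** * Systems of residues and convex functions *)

Lemma Posz_sum I (r : seq I) (P : pred I) (F : I -> nat) :
  Posz (\sum_(i <- r | P i) F i)%N = \sum_(i <- r | P i) Posz (F i).
Proof. exact: (big_morph Posz PoszD). Qed.

Section Convex.
Variable p : nat.

(** Representatives of all residues modulo p with the sum of p consecutive
    integers differ from these by multiples of p; the multiples cancel out. *)
Lemma contiguous_shift (v : 'I_p -> nat) f :
  (forall i j, v i = v j %[mod p] -> i = j) ->
  (\sum_i v i = p * f + \sum_(r < p) r)%N ->
  exists (r : 'I_p -> 'I_p) (c : 'I_p -> int),
    [/\ injective r, forall i, (v i)%:Z = (f + r i)%N%:Z + p%:Z * c i & \sum_i c i = 0].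
Proof.
case: p v => [|q] v inj sv.
  by exists id, (fun=> 0); split=> //; [case | rewrite big_ord0].
pose w i := (v i + f * q)%N.
have rP i : (w i %% q.+1 < q.+1)%N by rewrite ltn_pmod.
exists (fun i => Ordinal (rP i)), (fun i => (w i %/ q.+1)%N%:Z - f%:Z).
have inj_r : injective (fun i => Ordinal (rP i)).
  move=> i j /(congr1 val) /= e; apply: inj; apply/eqP.
  by rewrite -(eqn_modDr (f * q)); apply/eqP.
have vE i : (v i)%:Z = (f + Ordinal (rP i))%N%:Z + q.+1%:Z * ((w i %/ q.+1)%N%:Z - f%:Z).
  have e : (v i + f * q = w i %/ q.+1 * q.+1 + w i %% q.+1)%N by rewrite -divn_eq.
  move: e; rewrite /=; set a := (w i %/ _)%N; set b := (w i %% _)%N.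
  by move=> e; lia.
split=> //.
have e1 : (\sum_i v i)%N%:Z = \sum_i ((f + Ordinal (rP i))%N%:Z + q.+1%:Z * ((w i %/ q.+1)%N%:Z - f%:Z)).
  by rewrite [LHS]Posz_sum /=; apply: eq_bigr => i _; apply: vE.
move: e1; rewrite big_split /= -mulr_sumr sv.
have -> : \sum_(i < q.+1) Posz (f + Ordinal (rP i)) = (q.+1 * f + \sum_(r < q.+1) r)%N%:Z.
  rewrite -Posz_sum big_split /= sum_nat_const card_ord.
  by rewrite [in RHS](reindex_inj inj_r).
set b := (_ + _)%N => /eqP.
by rewrite -[X in X == _]addr0 (inj_eq (addrI _)) eq_sym mulf_eq0 => /orP[//|/eqP].
Qed.

Definition window_sum (h : nat -> nat) f := (\sum_(r < p) h (f + r))%N.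

Lemma window_sum_eq (h : nat -> nat) (v : 'I_p -> nat) f :
  (forall i j, v i = v j %[mod p] -> i = j) ->
  (\sum_i v i = p * f + \sum_(r < p) r)%N ->
  (forall i, f <= v i < f + p)%N -> (\sum_i h (v i) = window_sum h f)%N.
Proof.
move=> inj sv win; have [r [c [inj_r vE _]]] := contiguous_shift inj sv.
rewrite /window_sum [RHS](reindex_inj inj_r) /=; apply: eq_bigr => i _; congr h.
have := vE i; have := ltn_ord (r i); have := win i.
have [->|c1|c1] : [\/ c i = 0, 1 <= c i | c i <= -1]
    by case: (ltrgt0P (c i)) => ?; [apply: Or32|apply: Or33|apply: Or31]; lia.
- by lia.
- have : p%:Z <= p%:Z * c i by nia.
  by lia.
have : p%:Z * c i <= - p%:Z by nia.
by lia.
Qed.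

(** The discrete convexity used below: consecutive integers are the most
    concentrated representatives of the residues modulo p with a given sum. *)
Definition window_minimal (h : nat -> nat) := forall (v : 'I_p -> nat) f,
  (forall i j, v i = v j %[mod p] -> i = j) ->
  (\sum_i v i = p * f + \sum_(r < p) r)%N ->
  (window_sum h f <= \sum_i h (v i))%N.

(** A supporting line of h at a window suffices, as its slope t is multiplied by
    the sum of the shifts c i, which vanishes. *)
Lemma window_minimal_tangent (h : nat -> nat) :
  (forall f, exists t : int, forall (r : nat) (c : int) (v : nat), (r < p)%N ->
    v%:Z = (f + r)%N%:Z + p%:Z * c -> (h (f + r))%:Z + t * c <= (h v)%:Z) ->
  window_minimal h.
Proof.
move=> tang v f inj sv; have [t ht] := tang f.
have [r [c [inj_r vE c0]]] := contiguous_shift inj sv.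
rewrite -lez_nat /window_sum (reindex_inj inj_r) /=.
rewrite [X in X <= _]Posz_sum [X in _ <= X]Posz_sum /=.
have -> : \sum_i Posz (h (f + r i)%N) = \sum_i (Posz (h (f + r i)%N) + t * c i).
  by rewrite big_split /= -mulr_sumr c0 mulr0 addr0.
by apply: ler_sum => i _; apply: ht (vE i).
Qed.

(** The truncated subtraction makes this the convex function max(0, z - v). *)
Definition hinge (z v : nat) : nat := (z - v)%N.
Definition square (v : nat) : nat := (v * v)%N.

Lemma hinge_minimal z : window_minimal (hinge z).
Proof.
apply: window_minimal_tangent => f; rewrite /hinge.
(* The slope is that of the chord of the hinge between f and f + p. *)
exists ((z - (f + p))%N%:Z - (z - f)%N%:Z) => r c v rp ev.
have e0 : (z - (f + p))%N%:Z - (z - f)%N%:Z = (if (z <= f)%N then 0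
    else if (f + p <= z)%N then - p%:Z else f%:Z - z%:Z).
  by case: ifP => ?; [|case: ifP => ?]; lia.
rewrite e0; case: ifP => [?|nzf]; first by lia.
case: ifP => [?|nfz]; first by lia.
set y := (z%:Z - f%:Z); have -> : f%:Z - z%:Z = - y by rewrite /y; lia.
have y0 : 0 < y < p%:Z by rewrite /y; lia.
case: (ltrgt0P c) => c0; last by move: ev; rewrite c0 mulr0 addr0 => [] [->]; lia.
  have : y <= y * c by nia.
  by rewrite /y; lia.
have : (p%:Z - y) * 1 <= (p%:Z - y) * (- c) by apply: ler_wpM2l; lia.
by rewrite /y; move: ev rp; rewrite PoszD; nia.
Qed.

(** The slope is that of the square at the middle f + (p - 1) / 2 of the window:
    there the inequality is strict for every nonzero shift c. *)
Lemma square_tangent (f r v : nat) (c : int) : (r < p)%N ->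
  v%:Z = (f + r)%N%:Z + p%:Z * c ->
  (square (f + r))%:Z + p%:Z * (2 * f%:Z + p%:Z - 1) * c + `|c| <= (square v)%:Z.
Proof.
move=> rp ev; rewrite /square !PoszM ev PoszD.
rewrite -subr_ge0; set g := (X in 0 <= X).
have -> : g = c * (p%:Z * (2 * r%:Z + p%:Z * (c - 1) + 1)) - `|c| by rewrite /g; ring.
case: (ltrgt0P c) => c0; last by rewrite c0 mul0r.
  rewrite -[X in _ - X]mulr1 -mulrBr; apply: mulr_ge0; first exact: ltW.
  rewrite subr_ge0.
  have : 0 <= p%:Z * (c - 1) by apply: mulr_ge0; lia.
  by move: rp; clear; nia.
rewrite opprK -[X in _ + X]mulr1 -mulrDr -mulrNN; apply: mulr_ge0; first by lia.
have : 0 <= p%:Z * (- c - 1) by apply: mulr_ge0; lia.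
by move: rp; clear; nia.
Qed.

Lemma square_minimal : window_minimal square.
Proof.
apply: window_minimal_tangent => f.
exists (p%:Z * (2 * f%:Z + p%:Z - 1)) => r c v rp ev.
by apply: le_trans (square_tangent rp ev); rewrite lerDl.
Qed.

Lemma square_window (v : 'I_p -> nat) f :
  (forall i j, v i = v j %[mod p] -> i = j) ->
  (\sum_i v i = p * f + \sum_(r < p) r)%N ->
  (\sum_i square (v i) <= window_sum square f)%N ->
  forall i, (f <= v i < f + p)%N.
Proof.
move=> inj sv le; have [r [c [inj_r vE c0]]] := contiguous_shift inj sv.
pose t := p%:Z * (2 * f%:Z + p%:Z - 1).
have pt i : (square (f + r i))%:Z + t * c i + `|c i| <= (square (v i))%:Z.
  exact: square_tangent (vE i).
have : \sum_i `|c i| <= 0.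
  have l2 : \sum_i ((square (f + r i))%:Z + t * c i + `|c i|) <= \sum_i (square (v i))%:Z.
    by apply: ler_sum => i _; apply: pt.
  move: l2; rewrite !big_split /= -mulr_sumr c0 mulr0 addr0 => l2.
  move: le; rewrite /window_sum [X in (_ <= X)%N -> _](reindex_inj inj_r) /= -lez_nat !Posz_sum => l1.
  by have := le_trans l2 l1; rewrite gerDl.
move=> le0 i; have /eqP : `|c i| == 0.
  rewrite eq_le normr_ge0 andbT; apply: le_trans le0.
  by rewrite (bigD1 i) //= lerDl; apply: sumr_ge0.
move/eqP; rewrite normr_eq0 => /eqP ci.
by have := vE i; have := ltn_ord (r i); rewrite ci; lia.
Qed.

End Convex.

(** * Initial forms for a weight on the variables *)

Definition wdeg N (e : 'I_N -> nat) (u : 'X_{1..N}) : nat := (\sum_i u i * e i)%N.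

Lemma wdegD N (e : 'I_N -> nat) u v : wdeg e (u + v)%MM = (wdeg e u + wdeg e v)%N.
Proof. by rewrite /wdeg -big_split; apply: eq_bigr => i _; rewrite mnmDE mulnDl. Qed.

Lemma wdeg0 N (e : 'I_N -> nat) : wdeg e 0%MM = 0%N.
Proof. by rewrite /wdeg big1 // => i _; rewrite mnm0E. Qed.

Lemma wdegU N (e : 'I_N -> nat) i : wdeg e U_(i)%MM = e i.
Proof.
rewrite /wdeg (bigD1 i) //= mnm1E eqxx mul1n big1 ?addn0 // => j nji.
by rewrite mnm1E eq_sym (negPf nji).
Qed.

Lemma wdeg_sum N (e : 'I_N -> nat) I (r : seq I) (F : I -> 'X_{1..N}) :
  wdeg e (\sum_(i <- r) F i)%MM = (\sum_(i <- r) wdeg e (F i))%N.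
Proof. exact: (big_morph _ (wdegD e) (wdeg0 e)). Qed.

Section Lead.
Variables (k : fieldType) (N : nat) (e : 'I_N -> nat).
Implicit Types (P G : {mpoly k[N]}) (u : 'X_{1..N}).

(** Multiplying each variable by a power of a new variable turns the weight into
    the order of vanishing in the new variable. *)
Definition rescale P : {poly {mpoly k[N]}} :=
  mmap (polyC \o @mpolyC N k) (fun i => ('X_i)%:P * 'X^(e i)) P.

Lemma rescale0 : rescale 0 = 0. Proof. exact: rmorph0. Qed.

Lemma rescaleD : {morph rescale : P Q / P + Q}.
Proof. exact: rmorphD. Qed.

Lemma rescaleM : {morph rescale : P Q / P * Q}.
Proof. exact: rmorphM. Qed.

(** All terms of P have weight at least d, and G is the sum of those of weight d.
    G may vanish: this is how terms of larger weight are discarded. *)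
Definition has_lead d P G := exists H, rescale P = 'X^d * (G%:P + 'X * H).

Lemma has_leadD d P P' G G' :
  has_lead d P G -> has_lead d P' G' -> has_lead d (P + P') (G + G').
Proof.
case=> H eH [H' eH']; exists (H + H').
by rewrite rescaleD eH eH' polyCD /=; ring.
Qed.

Lemma has_lead0 d : has_lead d 0 0.
Proof. by exists 0; rewrite rescale0 polyC0; ring. Qed.

Lemma has_lead_sum d I (r : seq I) (Q : pred I) (F F' : I -> {mpoly k[N]}) :
  (forall i, Q i -> has_lead d (F i) (F' i)) ->
  has_lead d (\sum_(i <- r | Q i) F i) (\sum_(i <- r | Q i) F' i).
Proof.
move=> h; apply: (big_rec2 (fun P G => has_lead d P G)); first exact: has_lead0.
by move=> i P G Qi; apply: has_leadD; apply: h.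
Qed.

Lemma has_lead_sum0 d I (r : seq I) (Q : pred I) (F : I -> {mpoly k[N]}) :
  (forall i, Q i -> has_lead d (F i) 0) ->
  has_lead d (\sum_(i <- r | Q i) F i) 0.
Proof.
move=> h; have := @has_lead_sum d I r Q F (fun=> 0) h.
by rewrite (@big1 _ _ _ I r Q (fun=> 0)).
Qed.

Lemma has_leadM d d' P P' G G' :
  has_lead d P G -> has_lead d' P' G' -> has_lead (d + d') (P * P') (G * G').
Proof.
case=> H eH [H' eH']; exists (G%:P * H' + H * G'%:P + 'X * H * H').
by rewrite rescaleM eH eH' polyCM exprD /=; ring.
Qed.

Lemma has_leadC c : has_lead 0 c%:MP c%:MP.
Proof. by exists 0; rewrite mulr0 addr0 mul1r /rescale mmapC. Qed.

Lemma has_leadZ d c P G : has_lead d P G -> has_lead d (c *: P) (c *: G).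
Proof.
rewrite -!mul_mpolyC => h.
exact: (has_leadM (has_leadC c) h).
Qed.

Lemma has_lead_exp d P G t : has_lead d P G -> has_lead (t * d) (P ^+ t) (G ^+ t).
Proof.
move=> h; elim: t => [|t IH]; first by rewrite !expr0 -mpolyC1; exact: has_leadC.
by rewrite mulSn !exprS; apply: has_leadM h IH.
Qed.

Lemma has_lead_prod I (r : seq I) (d : I -> nat) (F F' : I -> {mpoly k[N]}) :
  (forall i, has_lead (d i) (F i) (F' i)) ->
  has_lead (\sum_(i <- r) d i) (\prod_(i <- r) F i) (\prod_(i <- r) F' i).
Proof.
move=> h; elim: r => [|i r IH]; first by rewrite !big_nil -mpolyC1; exact: has_leadC.
by rewrite !big_cons; apply: has_leadM (h i) IH.
Qed.

Lemma has_lead_lt d d' P G : (d < d')%N -> has_lead d' P G -> has_lead d P 0.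
Proof.
move=> lt [H eH]; exists ('X^(d' - d.+1) * (G%:P + 'X * H)).
rewrite eH polyC0 add0r !mulrA; congr (_ * _).
by rewrite -exprSr -exprD; congr ('X^_); lia.
Qed.

Lemma has_leadX u : has_lead (wdeg e u) 'X_[u] 'X_[u].
Proof.
exists 0; rewrite mulr0 addr0 /rescale mmapX /mmap1.
rewrite mpolyXE_id rmorph_prod /wdeg -prodrXr -big_split.
by apply: eq_bigr => i _; rewrite exprMn rmorphXn -exprM mulnC mulrC.
Qed.

Lemma has_lead_coef d P G t : has_lead d P G -> (t <= d)%N ->
  (rescale P)`_t = if d == t then G else 0.
Proof.
case=> H -> le; rewrite coefXnM; case: ltngtP le => // -> _.
by rewrite subnn coefD coefC coefXM addr0.
Qed.

End Lead.

Section AlgMap.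
Variables (k : fieldType) (p m n : nat).
Local Notation symb := (symb p m n).
Local Notation xidx := (xidx p m n).
Implicit Types (F G : symb -> {fpoly k[xidx]}) (d : symb -> nat).

Definition mass d (u : fmon symb) : nat := wdeg (fun i => d (enum_val i)) u.

Lemma massU d x : mass d U_(enum_rank x)%MM = d x.
Proof. by rewrite /mass wdegU enum_rankK. Qed.

Lemma alg_map0 F : alg_map F 0 = 0.
Proof. exact: rmorph0. Qed.

Lemma alg_mapD F : {morph alg_map F : f g / f + g}.
Proof. exact: rmorphD. Qed.

Lemma alg_mapB F : {morph alg_map F : f g / f - g}.
Proof. exact: rmorphB. Qed.

Lemma alg_mapM F : {morph alg_map F : f g / f * g}.
Proof. exact: rmorphM. Qed.

Lemma alg_mapZ F c f : alg_map F (c *: f) = c *: alg_map F f.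
Proof. by rewrite /alg_map mmapZ mul_mpolyC. Qed.

Lemma alg_map_sum F I (r : seq I) (P : pred I) (f : I -> {fpoly k[symb]}) :
  alg_map F (\sum_(i <- r | P i) f i) = \sum_(i <- r | P i) alg_map F (f i).
Proof. exact: (big_morph _ (alg_mapD F) (alg_map0 F)). Qed.

Lemma alg_mapE F (f : {fpoly k[symb]}) :
  alg_map F f = \sum_(u <- msupp f) f@_u *: alg_map F 'X_[u].
Proof. by rewrite {1}[f]mpolyE alg_map_sum; apply: eq_bigr => u _; apply: alg_mapZ. Qed.

Lemma alg_mapX F (u : fmon symb) : alg_map F 'X_[u] = \prod_i F (enum_val i) ^+ u i.
Proof. exact: mmapX. Qed.

Lemma alg_mapU F x : alg_map F 'X_(enum_rank x) = F x.
Proof. by rewrite /alg_map mmapX mmap1U enum_rankK. Qed.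

Lemma has_lead_monomial e d F G (u : fmon symb) :
  (forall x, has_lead e (d x) (F x) (G x)) ->
  has_lead e (mass d u) (alg_map F 'X_[u]) (alg_map G 'X_[u]).
Proof. by move=> h; rewrite !alg_mapX; apply: has_lead_prod => i; apply: has_lead_exp. Qed.

(** Initial forms of the elements of a kernel are in the kernel of the map given
    by the initial forms of the generators: compare the terms of least weight. *)
Lemma initial_form_relation e d F G f t :
  (forall x, has_lead e (d x) (F x) (G x)) -> alg_map F f = 0 ->
  (forall u, u \in msupp f -> (t <= mass d u)%N) ->
  \sum_(u <- msupp f | mass d u == t) f@_u *: alg_map G 'X_[u] = 0.
Proof.
move=> h f0 le; transitivity (rescale e (alg_map F f))`_t; last first.
  by rewrite f0 rescale0 coef0.
rewrite alg_mapE (big_morph _ (@rescaleD _ _ e) (rescale0 k e)) coef_sum.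
rewrite big_mkcond /= !big_seq; apply: eq_bigr => u uf.
rewrite (has_lead_coef (has_leadZ f@_u (has_lead_monomial u h)) (le u uf)).
by case: ifP.
Qed.

(** * Antidiagonals and shifted rows *)

Definition entry_row (v : xidx) : nat := (p * v.2 + v.1.1)%N.

(** The row x.2 + i carries the column of rank p - 1 - i: with these 0-based rows
    the columns decrease from one row to the next. *)
Definition antidiagonal_idx (x : symb) (i : 'I_p) : xidx :=
  (Ordinal (Lrow_mod (Lrow x.2 i)), cols x (rev_ord i), Ordinal (Lrow_div (Lrow x.2 i))).

Definition antidiagonal (x : symb) : fmon xidx :=
  (\sum_i U_(enum_rank (antidiagonal_idx x i)))%MM.

Definition antidiagonal_mon (u : fmon symb) : fmon xidx :=
  (\sum_i antidiagonal (enum_val i) *+ u i)%MM.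

Definition xdeg (e : xidx -> nat) (u : fmon xidx) := wdeg (fun i => e (enum_val i)) u.

Lemma xdeg_antidiagonal e x : xdeg e (antidiagonal x) = (\sum_i e (antidiagonal_idx x i))%N.
Proof.
rewrite /xdeg /antidiagonal wdeg_sum; apply: eq_bigr => i _.
by rewrite wdegU enum_rankK.
Qed.

Lemma entry_row_antidiagonal x (i : 'I_p) : entry_row (antidiagonal_idx x i) = (x.2 + i)%N.
Proof. by rewrite /entry_row /= mulnC -divn_eq. Qed.

Lemma wdegMn N (e : 'I_N -> nat) u t : wdeg e (u *+ t)%MM = (t * wdeg e u)%N.
Proof. by elim: t => [|t IH]; rewrite ?mulm0n ?wdeg0 // mulmS wdegD IH. Qed.

Lemma xdeg_antidiagonal_mon e u :
  xdeg e (antidiagonal_mon u) = mass (fun x => xdeg e (antidiagonal x)) u.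
Proof.
rewrite /xdeg /antidiagonal_mon wdeg_sum; apply: eq_bigr => i _.
by rewrite wdegMn.
Qed.

Lemma alg_map_antidiagonal (c : symb -> k) u :
  alg_map (fun x => c x *: 'X_[antidiagonal x]) 'X_[u] =
    (\prod_i c (enum_val i) ^+ u i) *: 'X_[antidiagonal_mon u].
Proof.
rewrite alg_mapX -mul_mpolyC rmorph_prod /antidiagonal_mon -mprodXnE -big_split /=.
by apply: eq_bigr => i _; rewrite exprZn -mul_mpolyC rmorphXn.
Qed.

End AlgMap.

Section Weights.
Variables (p m n : nat).
Local Notation symb := (symb p m n).
Local Notation xidx := (xidx p m n).
Implicit Types (x : symb) (h : nat -> nat).

(** Moving the columns from s on by p rows keeps all residues modulo p, and makes
    the antidiagonal of x a window of p consecutive rows that starts at level x s;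
    a weight in terms of these rows therefore detects the level at s. *)
Definition shifted_row (s : nat) (v : xidx) : nat := (entry_row v + p * (s <= v.1.2))%N.

Section Term.
Variables (x : symb) (rho : 'I_p -> nat) (sg : 'S_p).
Hypotheses (rho_inj : forall i j, rho i = rho j %[mod p] -> i = j)
  (rho_sum : (\sum_i rho i = p * x.2 + \sum_(r < p) r)%N).

Let v s i := (rho i + p * (s <= cols x (sg i)))%N.

Lemma shifted_inj s i j : v s i = v s j %[mod p] -> i = j.
Proof. by rewrite /v ![(p * _)%N]mulnC ![(_ + _ * p)%N]addnC !modnMDl; apply: rho_inj. Qed.

Lemma shifted_sum s : (\sum_i v s i = p * level x s + \sum_(r < p) r)%N.
Proof.
rewrite big_split /= rho_sum -big_distrr /= /level.
rewrite [X in (_ + p * X = _)%N](_ : _ = \sum_(i < p) (s <= cols x i))%N.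
  by rewrite mulnDr addnAC.
by rewrite [RHS](reindex_inj (@perm_inj _ sg)).
Qed.

Lemma term_minimal h s : window_minimal p h ->
  (window_sum p h (level x s) <= \sum_i h (v s i))%N.
Proof. by move=> hm; apply: hm; [apply: shifted_inj | apply: shifted_sum]. Qed.

(** A term that is minimal for the squares occupies a window for every s.  The
    windows at s = alpha and s = alpha + 1 leave a single row for the column
    alpha. *)
Lemma term_antidiagonal :
  (\sum_(s < (m + p).+1) \sum_i square (v s i) <=
   \sum_(s < (m + p).+1) window_sum p square (level x s))%N ->
  forall i, rho i = (x.2 + (p - (sg i).+1))%N.
Proof.
move=> le i.
have win (s : nat) : (s < (m + p).+1)%N -> (level x s <= v s i < level x s + p)%N.
  move=> ls; pose s' := Ordinal ls.
  apply: (square_window (@shifted_inj s) (shifted_sum s)).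
  rewrite leqNgt; apply/negP=> lt; move: le; rewrite leqNgt => /negP[].
  rewrite (bigD1 s') //= [X in (_ < X)%N](bigD1 s') //= -addSn leq_add //.
  by apply: leq_sum => t _; exact: (term_minimal t (@square_minimal p)).
have := ltn_ord (sg i); have := ltn_ord (cols x (sg i)) => lc ls.
have := win (cols x (sg i)); have := win (cols x (sg i)).+1.
rewrite /v /level count_cols count_colsS leqnn ltnn muln0 muln1.
by move=> /(_ lc)/andP[h1 _] /(_ (ltnW lc))/andP[_ h2]; lia.
Qed.

Lemma term_window h s : (forall i, rho i = x.2 + (p - (sg i).+1))%N ->
  (\sum_i h (v s i) = window_sum p h (level x s))%N.
Proof.
move=> e; apply: window_sum_eq; [exact: shifted_inj | exact: shifted_sum |].
move=> i; rewrite /v /level e leq_cols_count.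
have := ltn_ord (sg i); set c := (\sum_(j < p) _)%N => lt.
have cp : (c <= p)%N.
  by rewrite -[X in (_ <= X)%N]subn0 -sum_ord_ge; apply: leq_sum => j _; exact: leq_b1.
clearbody c; move: lt cp; move: (nat_of_ord (sg i)) (nat_of_ord x.2) => b a lt cp.
by case: (leqP (p - b) c) => ?; lia.
Qed.

End Term.

Lemma shifted_row_antidiagonal h s x :
  (\sum_i h (shifted_row s (antidiagonal_idx x i)) = window_sum p h (level x s))%N.
Proof.
pose sg : 'S_p := perm (@rev_ord_inj p).
rewrite -(@term_window x (fun i => x.2 + i)%N sg).
- by apply: eq_bigr => i _; rewrite /shifted_row entry_row_antidiagonal /sg permE.
- move=> i j /eqP; rewrite eqn_modDl !modn_small ?ltn_ord // => /eqP.
  exact: val_inj.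
- by rewrite big_split /= sum_nat_const card_ord.
- by move=> i; rewrite permE /=; have := ltn_ord i; lia.
Qed.

End Weights.

Section Leading.
Variables (k : fieldType) (p m n : nat).
Local Notation symb := (symb p m n).
Local Notation xidx := (xidx p m n).
Implicit Types (x y : symb) (u v : fmon symb) (e : xidx -> nat).
Local Notation lead e := (@has_lead k #|xidx| (fun i => e (enum_val i))).

(** The family th stands for the terms of chi(x) and for the terms of phi(x) with
    prescribed levels, which are both indexed by permutations. *)
Section Family.
Variables (x : symb) (th : 'S_p -> 'I_p -> xidx).
Hypotheses (th_col : forall sg i, (th sg i).1.2 = cols x (sg i))
  (th_inj : forall sg i j, entry_row (th sg i) = entry_row (th sg j) %[mod p] -> i = j)
  (th_sum : forall sg, (\sum_i entry_row (th sg i) = p * x.2 + \sum_(r < p) r)%N).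

(** The squares single out the antidiagonal.  The multiple N of the hinge lets
    the weight compare, for N large, the hinge alone. *)
Definition chain_weight (N z s : nat) (v : xidx) : nat :=
  (\sum_(t < (m + p).+1) square (shifted_row t v) + N * hinge z (shifted_row s v))%N.

Definition chain_mass (N z s : nat) y : nat :=
  (\sum_(t < (m + p).+1) window_sum p square (level y t) +
   N * window_sum p (hinge z) (level y s))%N.

Lemma chain_weight_strict N z s sg :
  (\sum_i chain_weight N z s (th sg i) <= chain_mass N z s x)%N ->
  forall i, entry_row (th sg i) = (x.2 + (p - (sg i).+1))%N.
Proof.
have eW h t : (\sum_i h (shifted_row t (th sg i)) =
    \sum_i h (entry_row (th sg i) + p * (t <= cols x (sg i))))%N.
  by apply: eq_bigr => i _; rewrite /shifted_row th_col.
rewrite /chain_weight big_split /= exchange_big /= -big_distrr /= eW.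
under eq_bigr => t _ do rewrite eW.
move=> le; apply: term_antidiagonal => //; first exact: th_inj.
rewrite -(leq_add2r (N * window_sum p (hinge z) (level x s))).
apply: leq_trans le; rewrite leq_add2l leq_mul2l; apply/orP; right.
by apply: term_minimal (@hinge_minimal p z) => //; apply: th_inj.
Qed.

End Family.

Lemma chain_weight_antidiagonal N z s x :
  (\sum_i chain_weight N z s (antidiagonal_idx x i) = chain_mass N z s x)%N.
Proof.
rewrite /chain_weight big_split /= exchange_big /= -big_distrr /= shifted_row_antidiagonal.
by congr (_ + _)%N; apply: eq_bigr => t _; rewrite shifted_row_antidiagonal.
Qed.

(** * Initial forms of the generators *)

Definition chi_idx x (sg : 'S_p) (i : 'I_p) : xidx :=
  (Ordinal (Lrow_mod (Lrow x.2 i)), cols x (sg i), Ordinal (Lrow_div (Lrow x.2 i))).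

Definition chi_gen x : {fpoly k[xidx]} := \det (mxsub (Lrow x.2) (cols x) (Lmx k p m n)).

Lemma entry_row_chi_idx x sg i : entry_row (chi_idx x sg i) = (x.2 + i)%N.
Proof. by rewrite /entry_row /= mulnC -divn_eq. Qed.

Lemma prod_xvar (th : 'I_p -> xidx) :
  \prod_i xvar k (th i).1.1 (th i).1.2 (th i).2 =
    'X_[(\sum_i U_(enum_rank (th i)))%MM].
Proof.
rewrite -mprodXE; apply: eq_bigr => i _; rewrite /xvar.
by case: (th i) => [[a b] c].
Qed.

Lemma chi_genE x : chi_gen x =
  \sum_(sg : 'S_p) (-1) ^+ sg *: 'X_[(\sum_i U_(enum_rank (chi_idx x sg i)))%MM].
Proof.
apply: eq_bigr => sg _; rewrite -prod_xvar.
rewrite -mul_mpolyC rmorphXn rmorphN1; congr (_ * _).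
by apply: eq_bigr => i _; rewrite !mxE.
Qed.

Lemma xdeg_family e (th : 'I_p -> xidx) :
  xdeg e (\sum_i U_(enum_rank (th i)))%MM = (\sum_i e (th i))%N.
Proof.
rewrite /xdeg wdeg_sum; apply: eq_bigr => i _.
by rewrite wdegU enum_rankK.
Qed.

Lemma has_lead_family e (th : 'I_p -> xidx) :
  lead e (\sum_i e (th i))%N 'X_[(\sum_i U_(enum_rank (th i)))%MM]
     'X_[(\sum_i U_(enum_rank (th i)))%MM].
Proof. by rewrite -xdeg_family; apply: has_leadX. Qed.

Definition antidiagonal_sign : k := (-1) ^+ perm (@rev_ord_inj p).

Lemma chi_lead N z s x :
  lead (chain_weight N z s) (chain_mass N z s x) (chi_gen x)
    (antidiagonal_sign *: 'X_[antidiagonal x]).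
Proof.
pose w0 : 'S_p := perm (@rev_ord_inj p).
have e0 i : chi_idx x w0 i = antidiagonal_idx x i by rewrite /chi_idx /antidiagonal_idx permE.
rewrite chi_genE (bigD1 w0) //= -[X in lead _ _ _ X]addr0.
apply: has_leadD.
  apply: has_leadZ; rewrite /antidiagonal -(chain_weight_antidiagonal N z s x).
  rewrite (_ : (\sum_i _)%MM = (\sum_i U_(enum_rank (antidiagonal_idx x i)))%MM).
    exact: has_lead_family.
  by apply: eq_bigr => i _; rewrite e0.
apply: has_lead_sum0 => sg nsg; rewrite -[X in lead _ _ _ X](scaler0 _ ((-1) ^+ sg : k)).
apply/has_leadZ/(has_lead_lt _ (has_lead_family _ _)); rewrite ltnNge; apply: contra nsg => le.
have inj sg' i j : entry_row (chi_idx x sg' i) = entry_row (chi_idx x sg' j) %[mod p] -> i = j.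
  move/eqP; rewrite !entry_row_chi_idx eqn_modDl !modn_small ?ltn_ord // => /eqP.
  exact: val_inj.
have h := @chain_weight_strict x (chi_idx x) _ inj _ N z s sg le.
apply/eqP/permP=> i; rewrite permE; apply: val_inj => /=.
have := h (fun _ _ => erefl _) _ i.
rewrite entry_row_chi_idx => hi.
have {}hi : (x.2 + i = x.2 + (p - (sg i).+1))%N.
  by apply: hi => sg'; under eq_bigr do rewrite entry_row_chi_idx;
     rewrite big_split /= sum_nat_const card_ord.
by have := ltn_ord (sg i); have := ltn_ord i; lia.
Qed.

End Leading.

Section PhiLeading.
Variables (k : fieldType) (p m n : nat).
Local Notation symb := (symb p m n).
Local Notation xidx := (xidx p m n).
Implicit Types (x y : symb) (u v : fmon symb) (e : xidx -> nat).
Local Notation lead e := (@has_lead k #|xidx| (fun i => e (enum_val i))).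

Definition phi_gen x : {fpoly k[xidx]} :=
  (\det (colsub (cols x) (Mt k p m n)))`_(x.2).

Definition phi_idx x (f : {ffun 'I_p -> 'I_n.+1}) (sg : 'S_p) (i : 'I_p) : xidx :=
  (i, cols x (sg i), f i).

Definition phi_part x (f : {ffun 'I_p -> 'I_n.+1}) : {fpoly k[xidx]} :=
  \det (\matrix_(i, j) xvar k i (cols x j) (f i)).

Lemma phi_partE x f : phi_part x f =
  \sum_(sg : 'S_p) (-1) ^+ sg *: 'X_[(\sum_i U_(enum_rank (phi_idx x f sg i)))%MM].
Proof.
apply: eq_bigr => sg _; rewrite -prod_xvar.
rewrite -mul_mpolyC rmorphXn rmorphN1; congr (_ * _).
by apply: eq_bigr => i _; rewrite !mxE.
Qed.

(** The coefficient of t^a collects the choices f of one level for each row of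
    M(t) with sum a. *)
Lemma phi_genE x : phi_gen x =
  \sum_(f : {ffun 'I_p -> 'I_n.+1} | (\sum_i f i == x.2)%N) phi_part x f.
Proof.
rewrite /phi_gen /determinant; under eq_bigr => sg _.
  under eq_bigr => i _ do rewrite !mxE.
  rewrite bigA_distr_bigA /=.
  under eq_bigr => f _.
    rewrite big_split /= -rmorph_prod prodrXr; over.
  over.
rewrite /= coef_sum [RHS]big_mkcond /= /phi_part /determinant.
under eq_bigr => sg _.
  rewrite -(rmorphN1 polyC) -rmorphXn /= coefCM coef_sum mulr_sumr.
  under eq_bigr => f _ do rewrite coefCM coefXn.
  over.
rewrite /= exchange_big /=; apply: eq_bigr => f _.
rewrite [(x.2 : nat) == _]eq_sym.
case: ifP => _; last by apply: big1 => sg _; rewrite !mulr0.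
apply: eq_bigr => sg _; rewrite mulr1; congr (_ * _).
by apply: eq_bigr => i _; rewrite mxE.
Qed.

Section Window.
Variable a : 'I_(n * p).+1.

(** The row of M(t) to which the row a + r of the stacked matrix belongs. *)
Definition residue (r : 'I_p) : 'I_p := Ordinal (Lrow_mod (Lrow a r)).

Lemma residue_inj : injective residue.
Proof.
move=> r s /(congr1 val) /= /eqP; rewrite eqn_modDl !modn_small ?ltn_ord // => /eqP.
exact: val_inj.
Qed.

Definition rotation : 'S_p := (perm residue_inj)^-1%g.

Lemma rotationK i : residue (rotation i) = i.
Proof. by rewrite -{1}(permE residue_inj) /rotation permKV. Qed.

Definition window_level : {ffun 'I_p -> 'I_n.+1} :=
  [ffun i => Ordinal (Lrow_div (Lrow a (rotation i)))].

Lemma window_levelE i : (p * window_level i + i = a + rotation i)%N.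
Proof.
rewrite ffunE /= [RHS](divn_eq _ p) [(p * _)%N]mulnC; congr (_ + _)%N.
by rewrite -{1}(rotationK i).
Qed.

(** The levels for which the chosen rows are the rows a, ..., a + p - 1 are unique,
    since p consecutive integers represent each residue once. *)
Lemma window_level_unique (f : {ffun 'I_p -> 'I_n.+1}) :
  (forall i : 'I_p, a <= p * f i + i < a + p)%N -> f = window_level.
Proof.
move=> h; apply/ffunP=> i; apply: val_inj => /=.
have p0 : (0 < p)%N by apply: leq_ltn_trans (ltn_ord i).
have lr : (p * f i + i - a < p)%N by have := h i; lia.
have er : (a + Ordinal lr = p * f i + i)%N by rewrite /=; have := h i; lia.
have ei : residue (Ordinal lr) = i.
  by apply: val_inj; rewrite /= -/(nat_of_ord (Ordinal lr)) er mulnC modnMDl modn_small.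
have -> : f i = ((a + Ordinal lr) %/ p)%N :> nat.
  by rewrite er mulnC divnMDl // divn_small ?addn0.
have -> : Ordinal lr = rotation i by apply: residue_inj; rewrite rotationK ei.
by rewrite ffunE.
Qed.

Lemma window_level_sum : (\sum_i window_level i = a)%N.
Proof.
case: (posnP p) => [p0|p0].
  rewrite big1 => [|i _]; last by have := ltn_ord i; rewrite {2}p0.
  by have := ltn_ord a; rewrite {2}p0 muln0; lia.
apply/eqP; rewrite -(eqn_pmul2l p0) big_distrr /= -(eqn_add2r (\sum_(i < p) i)%N) -big_split /=.
under eq_bigr => i _ do rewrite window_levelE.
by rewrite big_split /= sum_nat_const card_ord [X in (_ + X == _)%N](_ : _ = \sum_(i < p) i)%N //
  [RHS](reindex_inj (@perm_inj _ rotation)).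
Qed.

End Window.

Definition phi_sign (x : symb) : k := (-1) ^+ rotation x.2.

(** The same p rows as in chi(x), in the order of their residues: hence the sign. *)
Lemma phi_part_window x : phi_part x (window_level x.2) = phi_sign x *: chi_gen k x.
Proof.
rewrite /phi_part /chi_gen (_ : \matrix_(i, j) _ =
    row_perm (rotation x.2) (mxsub (Lrow x.2) (cols x) (Lmx k p m n))); last first.
  apply/matrixP=> i j; rewrite !mxE; congr xvar; last by rewrite ffunE.
  by rewrite -{1}(rotationK x.2 i).
by rewrite row_permE det_mulmx det_perm -mul_mpolyC rmorphXn rmorphN1.
Qed.

Lemma entry_row_phi_idx x f sg i : entry_row (phi_idx x f sg i) = (p * f i + i)%N.
Proof. by []. Qed.

(** Whenever the weight is minimal only at the window of levels, phi(x) has the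
    initial form of chi(x), up to sign. *)
Lemma phi_lead e d x G :
  (forall (f : {ffun 'I_p -> 'I_n.+1}) (sg : 'S_p), (\sum_i f i = x.2)%N ->
     (\sum_i e (phi_idx x f sg i) <= d)%N ->
     f = window_level x.2) ->
  lead e d (chi_gen k x) G -> lead e d (phi_gen x) (phi_sign x *: G).
Proof.
move=> hf hG; rewrite phi_genE (bigD1 (window_level x.2)) /=; last first.
  by rewrite window_level_sum.
rewrite -[X in lead _ _ _ X]addr0; apply: has_leadD.
  by rewrite phi_part_window; apply: has_leadZ.
apply: has_lead_sum0 => f /andP[/eqP sf nf]; rewrite phi_partE.
apply: has_lead_sum0 => sg _.
rewrite -[X in lead _ _ _ X](scaler0 _ ((-1) ^+ sg : k)).
apply/has_leadZ/(has_lead_lt _ (has_lead_family _ _ _)); rewrite ltnNge.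
by apply: contra nf => le; apply/eqP/(hf f sg).
Qed.

Lemma entry_row_phi_inj x f sg i j :
  entry_row (phi_idx x f sg i) = entry_row (phi_idx x f sg j) %[mod p] -> i = j.
Proof.
rewrite !entry_row_phi_idx ![(p * _)%N]mulnC !modnMDl !modn_small ?ltn_ord //.
exact: val_inj.
Qed.

Lemma entry_row_phi_sum x (f : {ffun 'I_p -> 'I_n.+1}) sg : (\sum_i f i = x.2)%N ->
  (\sum_i entry_row (phi_idx x f sg i) = p * x.2 + \sum_(r < p) r)%N.
Proof.
by move=> <-; under eq_bigr do rewrite entry_row_phi_idx; rewrite big_split /= big_distrr.
Qed.

Lemma phi_lead_chain N z s x :
  lead (chain_weight N z s) (chain_mass N z s x) (phi_gen x)
    ((phi_sign x * antidiagonal_sign k p) *: 'X_[antidiagonal x]).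
Proof.
rewrite -scalerA; apply: phi_lead (chi_lead _ _ _ _ _) => f sg sf le.
apply: window_level_unique => i; rewrite -(entry_row_phi_idx x f sg i).
have h := @chain_weight_strict p m n x (fun sg => phi_idx x f sg) _ _ _ N z s sg le.
rewrite h //; [have := ltn_ord (sg i); lia | exact: entry_row_phi_inj |].
by move=> ?; apply: entry_row_phi_sum.
Qed.

Definition square_weight (v : xidx) := square (entry_row v).

Lemma chi_lead_square x :
  lead square_weight (window_sum p square x.2) (chi_gen k x) (chi_gen k x).
Proof.
rewrite chi_genE; apply: has_lead_sum => sg _; apply: has_leadZ.
rewrite (_ : window_sum p square x.2 = \sum_i square_weight (chi_idx x sg i))%N.
  exact: has_lead_family.
by apply: eq_bigr => i _; rewrite /square_weight entry_row_chi_idx.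
Qed.

Lemma phi_lead_square x :
  lead square_weight (window_sum p square x.2) (phi_gen x) (phi_sign x *: chi_gen k x).
Proof.
apply: phi_lead (chi_lead_square x) => f sg sf le.
apply: window_level_unique => i; rewrite -(entry_row_phi_idx x f sg i).
exact: (square_window (@entry_row_phi_inj x f sg) (entry_row_phi_sum sg sf)).
Qed.

End PhiLeading.

(** * Linear independence of standard monomials *)

Lemma exists_min (T : eqType) (d : T -> nat) (s : seq T) : s != [::] ->
  exists2 a, a \in s & forall b, b \in s -> (d a <= d b)%N.
Proof.
elim: s => // a s IH _; case: (eqVneq s [::]) => [->|/IH[b bs minb]].
  by exists a => [|b]; rewrite inE // => /eqP ->.
case: (leqP (d a) (d b)) => [le|/ltnW le].
  exists a; rewrite ?mem_head // => c; rewrite inE => /predU1P[->//|/minb].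
  exact: leq_trans.
by exists b; rewrite ?inE ?bs ?orbT // => c; rewrite inE => /predU1P[->//|/minb].
Qed.

Section Independence.
Variables (k : fieldType) (p m n : nat) (lin : rel (symb p m n)).
Hypotheses (p_gt0 : (0 < p)%N) (lin_ext : linear_extension lin).
Local Notation symb := (symb p m n).
Local Notation xidx := (xidx p m n).
Implicit Types (x y : symb) (u v : fmon symb).
Local Notation std := (standard (@incomparable p m n)).

(** The weight of the product of the antidiagonals of u for a single hinge.  It is
    positive exactly when some symbol of u has level less than z at s. *)
Definition hinge_mass (z s : nat) u : nat :=
  mass (fun x => window_sum p (hinge z) (level x s)) u.

Lemma hinge_gt0 z f : (0 < window_sum p (hinge z) f)%N = (f < z)%N.
Proof.
rewrite lt0n sum_nat_eq0; case: (ltnP f z) => h.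
  apply/negP=> /forallP/(_ (Ordinal p_gt0)) /=; rewrite /hinge addn0; lia.
apply/negbF/forallP=> r /=; rewrite /hinge; lia.
Qed.

Lemma massD d u v : mass d (u + v)%MM = (@mass p m n d u + mass d v)%N.
Proof. exact: wdegD. Qed.

Lemma mass_gt0 (d : symb -> nat) u :
  reflect (exists2 x, expo u x != 0%N & (0 < d x)%N) (0 < mass d u)%N.
Proof.
rewrite lt0n sum_nat_eq0 negb_forall; apply: (iffP existsP) => [[i]|[x ux dx]].
  rewrite /= muln_eq0 negb_or => /andP[ui di]; exists (enum_val i).
    by rewrite /expo enum_valK.
  by rewrite lt0n.
by exists (enum_rank x); rewrite /= muln_eq0 negb_or ux enum_rankK -lt0n.
Qed.

Lemma standard_comparable u x y : std u -> expo u x != 0%N -> expo u y != 0%N ->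
  symb_le x y || symb_le y x.
Proof.
move=> /standardP su ux uy; apply/idPn; rewrite negb_or => inc.
have /negP := su _ _ inc; apply; apply/mnm_lepP=> i.
rewrite mnmDE !mnm1E; case: (eqVneq (enum_rank x) i) ux => [<-|_] ux.
  case: (eqVneq (enum_rank y)) => [/enum_rank_inj exy|_]; last by rewrite addn0 lt0n.
  by move: inc; rewrite exy symb_le_refl.
by case: (eqVneq (enum_rank y) i) uy => [<-|_] // uy; rewrite add0n lt0n.
Qed.

Lemma standard_least u : std u -> u != 0%MM ->
  exists2 x, expo u x != 0%N & forall y, expo u y != 0%N -> symb_le x y.
Proof.
case: lin_ext => _ anti tr tot ext su nu.
have [x0 ux0] : exists x : symb, expo u x != 0%N.
  apply/existsP; rewrite -negb_forall; apply: contra nu => /forallP h.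
  apply/eqP/expo_inj => x; rewrite (eqP (h x)); by rewrite /expo mnm0E.
have [x ux minx] := @lin_least _ _ anti tr tot [pred x | expo u x != 0%N] x0 ux0.
exists x => // y uy; have /orP[//|yx] := standard_comparable su ux uy.
by rewrite (anti x y) ?symb_le_refl // (minx y uy) ext.
Qed.

(** The hinge masses tell, for every s, the least level at s of the symbols of a
    monomial; for a chain these are the levels of its least symbol, which can then
    be removed. *)
Lemma standard_inj u v : std u -> std v ->
  (forall z s, hinge_mass z s u = hinge_mass z s v) -> u = v.
Proof.
have [N] := ubnP (mdeg u); elim: N u v => // N IH u v ltN su sv h.
have nz u' v' : (forall z s, hinge_mass z s u' = hinge_mass z s v') ->
    v' = 0%MM -> u' = 0%MM.
  move=> h' v0; apply/expo_inj => x; rewrite [RHS]/expo mnm0E.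
  apply/eqP/idPn => ux; have : (0 < hinge_mass (level x 0).+1 0 u')%N.
    by apply/mass_gt0; exists x => //; rewrite hinge_gt0.
  by rewrite h' v0 /hinge_mass /mass wdeg0.
case: (eqVneq u 0%MM) => [u0|nu]; first by rewrite u0 (nz v u) // => z s.
case: (eqVneq v 0%MM) => [v0|nv]; first by rewrite v0 (nz u v).
have [x ux lex] := standard_least su nu; have [y vy ley] := standard_least sv nv.
have mE w t (wt : expo w t != 0%N) (le : forall t', expo w t' != 0%N -> symb_le t t') z s :
    (0 < hinge_mass z s w)%N = (level t s < z)%N.
  apply/mass_gt0/idP => [[t' wt']|lt]; last by exists t; rewrite ?hinge_gt0.
  rewrite hinge_gt0; apply: leq_ltn_trans.
  by have /symb_le_level := le _ wt'; apply.
have exy : x = y.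
  apply: level_inj => s.
  have e z : (level x s < z)%N = (level y s < z)%N by rewrite -(mE u) // -(mE v) // h.
  by apply/anti_leq/andP; split; rewrite -ltnS; [rewrite e | rewrite -e]; apply: ltnSn.
have lu : (U_(enum_rank x) <= u)%MM by rewrite lep1mP.
have lv : (U_(enum_rank x) <= v)%MM by rewrite lep1mP exy.
rewrite -(submK lu) -(submK lv); congr (_ + _)%MM; apply: IH.
- by move: ltN; rewrite -{1}(submK lu) mdegD mdeg1; lia.
- apply/standardP=> a b ab; apply: contra (standardP _ _ su a b ab) => /lepm_trans; apply.
  exact: lem_subr.
- apply/standardP=> a b ab; apply: contra (standardP _ _ sv a b ab) => /lepm_trans; apply.
  exact: lem_subr.
move=> z s; have := h z s; rewrite -{1}(submK lu) -{1}(submK lv) /hinge_mass !massD.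
exact: addIn.
Qed.

Lemma antidiagonal_mon_inj u v :
  std u -> std v -> antidiagonal_mon u = antidiagonal_mon v -> u = v.
Proof.
move=> su sv e; apply: standard_inj => // z s.
have h w : hinge_mass z s w = xdeg (fun t : xidx => hinge z (shifted_row s t)) (antidiagonal_mon w).
  rewrite xdeg_antidiagonal_mon; apply: eq_bigr => i _; congr (_ * _)%N.
  by rewrite xdeg_antidiagonal shifted_row_antidiagonal.
by rewrite !h e.
Qed.

(** If all monomials of least mass in f were standard, their initial monomials,
    being distinct, could not cancel. *)
Lemma kernel_nonstandard e d (F : symb -> {fpoly k[xidx]}) (c : symb -> k) f :
  (forall x, has_lead e (d x) (F x) (c x *: 'X_[antidiagonal x])) ->
  (forall x, c x != 0) -> alg_map F f = 0 -> f != 0 ->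
  exists2 u, u \in msupp f /\ ~~ std u & forall v, v \in msupp f -> (mass d u <= mass d v)%N.
Proof.
move=> hF c0 Ff nf.
have [u0 u0f minu] : exists2 u0, u0 \in msupp f &
    forall v, v \in msupp f -> (mass d u0 <= mass d v)%N.
  by apply: exists_min; rewrite msupp_eq0.
have [|/hasPn allstd] := boolP (has (fun u => (mass d u == mass d u0) && ~~ std u) (msupp f)).
  by case/hasP=> u uf /andP[/eqP eu nu]; exists u => // v /minu; rewrite eu.
have := initial_form_relation hF Ff minu => /(congr1 (mcoeff (antidiagonal_mon u0))).
have st u : u \in msupp f -> mass d u == mass d u0 -> std u.
  by move=> /allstd; rewrite negb_and negbK => /orP[/negPf->|].
rewrite mcoeff0 -big_filter raddf_sum /=.
rewrite (bigD1_seq u0) ?filter_uniq ?msupp_uniq ?mem_filter ?eqxx //=.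
rewrite alg_map_antidiagonal !mcoeffZ mcoeffX eqxx mulr1.
rewrite [X in _ + X]big_seq_cond [X in _ + X]big1 => [|u]; last first.
  rewrite mem_filter => /andP[/andP[eu uf] nu].
  rewrite alg_map_antidiagonal !mcoeffZ mcoeffX; case: eqP => [e0|_]; last by rewrite !mulr0.
  by move: nu; rewrite (antidiagonal_mon_inj _ _ e0) ?eqxx // st.
move/eqP; rewrite addr0 mulf_eq0 mcoeff_eq0 u0f /=.
suff /negPf-> : \prod_i c (enum_val i) ^+ u0 i != 0 by [].
by rewrite prodf_seq_neq0; apply/allP=> i _; rewrite expf_neq0.
Qed.

End Independence.

(** * Laplace expansion along two blocks of rows *)

Section Laplace.
Variables (R : comNzRingType) (p : nat).
Implicit Types (A C : 'M[R]_(p, p + p)) (s : 'S_(p + p)) (J : {set 'I_(p + p)}).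

Definition top_set s : {set 'I_(p + p)} := [set s (lshift p i) | i : 'I_p].

(** The term of the expansion that belongs to the set J of columns used by the top
    rows.  Written as a determinant of masked blocks it carries its own sign. *)
Definition laplace_term A C J : R :=
  \det (col_mx (\matrix_(i, j) if j \in J then A i j else 0)
               (\matrix_(i, j) if j \in J then 0 else C i j)).

Lemma det_col_mx A C : \det (col_mx A C) = \sum_(s : 'S_(p + p))
  (-1) ^+ s * (\prod_i A i (s (lshift p i)) * \prod_i C i (s (rshift p i))).
Proof.
apply: eq_bigr => s _; congr (_ * _); rewrite big_split_ord /=.
by congr (_ * _); apply: eq_bigr => i _; rewrite ?col_mxEu ?col_mxEd.
Qed.

Lemma top_setP s J : reflect
  ((forall i, s (lshift p i) \in J) /\ forall i, s (rshift p i) \notin J)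
  (top_set s == J).
Proof.
apply: (iffP eqP) => [<-|[h1 h2]].
  split=> i; first exact: imset_f.
  by apply/imsetP=> -[j _ /perm_inj/eqP]; rewrite eq_rlshift.
apply/setP=> q; apply/imsetP/idP => [[i _ ->]|qJ]; first exact: h1.
have := permKV s q; case: (split_ordP (s^-1%g q)) => i -> e.
  by exists i.
by move: (h2 i); rewrite e qJ.
Qed.

Lemma laplace_termE A C J : laplace_term A C J = \sum_(s : 'S_(p + p) | top_set s == J)
  (-1) ^+ s * (\prod_i A i (s (lshift p i)) * \prod_i C i (s (rshift p i))).
Proof.
rewrite /laplace_term det_col_mx [RHS]big_mkcond; apply: eq_bigr => s _.
case: top_setP => [[h1 h2]|h].
  congr (_ * (_ * _)); apply: eq_bigr => i _; rewrite mxE ?h1 //.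
  by rewrite (negPf (h2 i)).
case: (boolP [forall i, s (lshift p i) \in J]) => [/forallP h1|].
  case: (boolP [forall i, s (rshift p i) \notin J]) => [/forallP h2|].
    by case: h.
  rewrite negb_forall => /existsP[i]; rewrite negbK => iJ.
  by rewrite [X in _ * (_ * X)](bigD1 i) //= mxE iJ mul0r !mulr0.
rewrite negb_forall => /existsP[i iJ].
by rewrite (bigD1 i) //= mxE (negPf iJ) !mul0r mulr0.
Qed.

Lemma laplace A C : \det (col_mx A C) = \sum_J laplace_term A C J.
Proof.
rewrite det_col_mx (partition_big top_set xpredT) //=.
by apply: eq_bigr => J _; rewrite laplace_termE.
Qed.

(** Any permutation that brings the columns J to the front may be used: the sign
    of the permutation compensates for the order that it gives to the columns. *)
Lemma laplace_term_top A C s : laplace_term A C (top_set s) =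
  (-1) ^+ s * (\det (colsub (s \o @lshift p p) A) * \det (colsub (s \o @rshift p p) C)).
Proof.
set M := col_mx (\matrix_(i, j) if j \in top_set s then A i j else 0)
               (\matrix_(i, j) if j \in top_set s then 0 else C i j).
have [h1 h2] := top_setP s (top_set s) (eqxx _).
have e : col_perm s M = block_mx (colsub (s \o @lshift p p) A) 0 0 (colsub (s \o @rshift p p) C).
  apply/matrixP=> i j; rewrite mxE /M; case: (split_ordP i) => i' ->; case: (split_ordP j) => j' ->.
  - by rewrite block_mxEul col_mxEu !mxE h1.
  - by rewrite block_mxEur col_mxEu !mxE (negPf (h2 _)).
  - by rewrite block_mxEdl col_mxEd !mxE h1.
  - by rewrite block_mxEdr col_mxEd !mxE (negPf (h2 _)).
have : \det (col_perm s M) = (-1) ^+ s * \det M.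
  by rewrite col_permE det_mulmx det_perm odd_permV mulrC.
by rewrite e det_ublock /laplace_term -/M => ->; rewrite mulrA -expr2 sqrr_sign mul1r.
Qed.

Lemma laplace_term_eq0 A C J : (forall s, top_set s != J) -> laplace_term A C J = 0.
Proof. by move=> h; rewrite laplace_termE big1 // => s; rewrite (negPf (h s)). Qed.

Lemma det_col0 q (M : 'M[R]_q) j : (forall i, M i j = 0) -> \det M = 0.
Proof. by move=> h; rewrite (expand_det_col M j) big1 // => i _; rewrite h mul0r. Qed.

End Laplace.

(** * Polynomials divisible by a power of t - s *)

Section Diagonal.
Variable K : comNzRingType.
Implicit Types (P : {poly K}) (G H : {poly {poly K}}) (q : nat -> int).

Definition var_diff : {poly {poly K}} := 'X - 'X%:P.

Lemma var_diff_dvd P : exists Q, P%:P - map_poly polyC P = var_diff * Q.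
Proof.
have /factor_theorem[Q eQ] : root (P%:P - map_poly polyC P) 'X.
  rewrite /root hornerD hornerN hornerC.
  have -> : (map_poly polyC P).['X] = P.
    by rewrite -[RHS]comp_polyXr /comp_poly.
  by rewrite subrr.
by exists Q; rewrite eQ mulrC.
Qed.

(** The linear form with coefficients q vanishes on the coefficients of each total
    degree T, for all multiples of (t - s)^E.  In characteristic 0 these are the q
    that are polynomials of degree less than E. *)
Definition annihilates E q := forall T H,
  \sum_(a < T.+1) ((var_diff ^+ E * H)`_a)`_(T - a) *~ q a = 0.

Lemma coef_var_diffM G a b : ((var_diff * G)`_a)`_b =
  (if a is a'.+1 then (G`_a')`_b else 0) - (if b is b'.+1 then (G`_a)`_b' else 0).
Proof.
rewrite /var_diff mulrBl coefB coefXM coefCM coefB coefXM.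
by case: a b => [|a] [|b]; rewrite /= ?coef0.
Qed.

(** Multiplication by t - s amounts to a difference operator on q. *)
Lemma annihilatesS E q : annihilates E (fun a => q a.+1 - q a) -> annihilates E.+1 q.
Proof.
move=> ann T H; rewrite exprS -mulrA; set G := _ * H.
under eq_bigr => a _ do rewrite coef_var_diffM mulrzBl.
rewrite sumrB; case: T => [|T].
  by rewrite !big_ord1 /= !mul0rz subrr.
rewrite big_ord_recl /= mul0rz add0r.
rewrite [X in _ - X]big_ord_recr /= subnn mul0rz addr0.
rewrite -[RHS](ann T H) -sumrB; apply: eq_bigr => a _.
rewrite /bump /= add1n subSS -/G mulrzBr; congr (_ - _).
by have la := ltn_ord a; rewrite subSn.
Qed.

(** The form is the binomial coefficient of a - c - 1 over e.  It is built by
    repeated summation, since a - c - 1 may be negative. *)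
Lemma annihilator e c : exists q, [/\ annihilates e.+1 q, q c = (-1) ^+ e &
  forall i, (0 < i <= e)%N -> q (c + i)%N = 0].
Proof.
elim: e => [|e [q [ann qc q0]]].
  exists (fun=> 1); split; [|by []|by case=> [|i] //; lia].
  by apply: annihilatesS => T H; rewrite big1 // => a _; rewrite /= subrr mulr0z.
pose S b : int := \sum_(i < b) q i.
have SS b : S b.+1 = S b + q b by rewrite /S big_ord_recr.
exists (fun b => S b - S c.+1); split.
- move=> T H; have := @annihilatesS e.+1 (fun b => S b - S c.+1) _ T H; apply.
  move=> T' H'; rewrite -[RHS](ann T' H'); apply: eq_bigr => a _; congr (_ *~ _).
  by rewrite SS; ring.
- by rewrite SS qc exprS; ring.
move=> i /andP[i0 ie]; apply/eqP; rewrite subr_eq0; apply/eqP.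
case: i i0 ie => // i _ ie; rewrite addnS -addSn.
elim: i ie => [|i IH] ie; first by rewrite addn0.
rewrite addnS SS IH; last exact: ltnW.
by rewrite addSnnS q0 ?addr0 //; lia.
Qed.

End Diagonal.

(** * Straightening *)

Section Minors.
Variables (k : fieldType) (p m n : nat).
Local Notation symb := (symb p m n).
Local Notation K := {fpoly k[xidx p m n]}.
Local Notation Mt := (Mt k p m n).
Implicit Types (x y : symb) (h : 'I_p -> 'I_(m + p)).

Definition minor h : {poly K} := \det (colsub h Mt).

Lemma phi_minor x : phi_gen k x = (minor (cols x))`_(x.2).
Proof. by []. Qed.

Lemma size_minor h : (size (minor h) <= (n * p).+1)%N.
Proof.
apply: (leq_trans (size_sum _ _ _)); apply/bigmax_leqP => s _.
rewrite -[(-1) ^+ _](rmorph_sign polyC) /= mul_polyC.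
apply: leq_trans (size_scale_leq _ _) _.
have h1 i : (size (colsub h Mt i (s i)) <= n.+1)%N.
  rewrite !mxE; apply: (leq_trans (size_sum _ _ _)); apply/bigmax_leqP => l _.
  rewrite mul_polyC; apply: leq_trans (size_scale_leq _ _) _.
  by rewrite size_polyXn ltn_ord.
apply: (leq_trans (size_prod_leq _ _)); rewrite card_ord.
have : (\sum_i size (colsub h Mt i (s i)) <= \sum_(i < p) n.+1)%N.
  by apply: leq_sum => i _.
rewrite sum_nat_const card_ord; move: (\sum_i _)%N => S; nia.
Qed.

(** Arbitrary column functions arise in the exchange relations; this brings them
    back to symbols, and keeps the sum of the columns for the induction. *)
Lemma minor_sort h : minor h = 0 \/
  exists (al : pseq p m) (b : bool), minor h = (-1) ^+ b * minor (tnth (sval al)) /\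
    (\sum_i tnth (sval al) i = \sum_i h i)%N.
Proof.
case: (boolP (injectiveb h)) => [/injectiveP h_inj|/injectivePn[i [j nij eij]]]; last first.
  left; rewrite /minor -det_tr; apply: (determinant_alternate nij) => a.
  by rewrite !mxE eij.
right.
have [s es] : exists s : 'S_p, sort_tuple (fun a b : 'I_(m + p) => (a <= b)%N) (mktuple h) =
    [tuple tnth (mktuple h) (s i) | i < p] :> seq _.
  by apply/tuple_permP; rewrite perm_sort.
have e i : tnth (sort_tuple (fun a b : 'I_(m + p) => (a <= b)%N) (mktuple h)) i = h (s i).
  by rewrite (val_inj es) !tnth_mktuple.
set t := sort_tuple _ _ in es e.
have st : sorted ltn [seq nat_of_ord j | j <- t].
  rewrite ltn_sorted_uniq_leq map_inj_uniq; last exact: val_inj.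
  rewrite sort_uniq map_inj_uniq // enum_uniq /= sorted_map.
  by apply: sort_sorted => a b; apply: leq_total.
exists (exist _ t st), s; split=> /=.
  rewrite /minor (_ : colsub (tnth t) Mt = col_perm s (colsub h Mt)).
    by rewrite col_permE det_mulmx det_perm odd_permV mulrC -mulrA -expr2 sqrr_sign mulr1.
  by apply/matrixP=> i j; rewrite !mxE e.
under eq_bigr => i _ do rewrite e.
by rewrite [RHS](reindex_inj (@perm_inj _ s)).
Qed.

End Minors.

Lemma coef_signM (K : comNzRingType) (b : bool) (P : {poly K}) i :
  ((-1) ^+ b * P)`_i = (-1) ^+ b * P`_i.
Proof. by rewrite -(rmorph_sign polyC) /= coefCM. Qed.

Section Straightening.
Variables (k : fieldType) (p m n : nat).
Local Notation symb := (symb p m n).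
Local Notation K := {fpoly k[xidx p m n]}.
Local Notation Mt := (Mt k p m n).
Implicit Types (x y : symb) (h : 'I_p -> 'I_(m + p)).
Local Notation phi := (@phi k p m n).

(** The degree T is kept because the weight of a pair determines the order of the
    square masses only when the sum of the two degrees is fixed. *)
Definition quadratic_standard (T : nat) (f : K) := exists g : {fpoly k[symb]}, phi g = f /\
  forall u, u \in msupp g -> exists x y, [/\ u = (U_(enum_rank x) + U_(enum_rank y))%MM,
    symb_le x y & (x.2 + y.2)%N = T].

Lemma quadratic_standardD T f g :
  quadratic_standard T f -> quadratic_standard T g -> quadratic_standard T (f + g).
Proof.
case=> f' [<- hf] [g' [<- hg]]; exists (f' + g'); split; first exact: alg_mapD.
by move=> u /msuppD_le; rewrite mem_cat => /orP[/hf|/hg].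
Qed.

Lemma quadratic_standardZ T c f : quadratic_standard T f -> quadratic_standard T (c *: f).
Proof.
case=> f' [<- hf]; exists (c *: f'); split; first exact: alg_mapZ.
by move=> u /msuppZ_le/hf.
Qed.

Lemma quadratic_standard0 T : quadratic_standard T 0.
Proof. by exists 0; split; [exact: alg_map0 | move=> u; rewrite msupp0]. Qed.

Lemma quadratic_standard_sign T b f :
  quadratic_standard T f -> quadratic_standard T ((-1) ^+ (b : bool) * f).
Proof.
by rewrite -(rmorph_sign (@mpolyC #|xidx p m n| k)) mul_mpolyC; apply: quadratic_standardZ.
Qed.

Lemma quadratic_standard_int T (c : int) f : quadratic_standard T f -> quadratic_standard T (f *~ c).
Proof. by rewrite -scaler_int; apply: quadratic_standardZ. Qed.

Lemma quadratic_standard_sum T I (r : seq I) (P : pred I) (F : I -> K) :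
  (forall i, P i -> quadratic_standard T (F i)) -> quadratic_standard T (\sum_(i <- r | P i) F i).
Proof.
by move=> hF; apply: big_ind => //; [apply: quadratic_standard0 | apply: quadratic_standardD].
Qed.

Lemma quadratic_standard_le x y : symb_le x y ->
  quadratic_standard (x.2 + y.2) (phi_gen k x * phi_gen k y).
Proof.
move=> le; exists 'X_[(U_(enum_rank x) + U_(enum_rank y))%MM]; split.
  by rewrite mpolyXD /phi alg_mapM !alg_mapU.
by move=> u; rewrite msuppX inE => /eqP ->; exists x, y.
Qed.

(** Here i0 and j0 witness that x <= y fails.  The columns of y up to j0 and those
    of x from i0 on form a strictly increasing sequence of p + 1 + (y.2 - x.2)
    columns, which are the ones that occur in both blocks below. *)
Section Exchange.
Variables (x y : symb) (i0 j0 : 'I_p).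
Hypotheses (lexy : (x.2 <= y.2)%N) (ej0 : j0 = (y.2 - x.2 + i0)%N :> nat)
  (ltyx : (cols y j0 < cols x i0)%N).
Local Notation T := (x.2 + y.2)%N.

Definition exchange_col (q : 'I_(p + p)) : 'I_(m + p) :=
  match split q with inl j => cols x j | inr j => cols y j end.
Definition in_top (q : 'I_(p + p)) : bool :=
  match split q with inl _ => true | inr j => (j <= j0)%N end.
Definition in_bottom (q : 'I_(p + p)) : bool :=
  match split q with inl j => (i0 <= j)%N | inr _ => true end.

Definition top_mx : 'M[{poly {poly K}}]_(p, p + p) :=
  \matrix_(i, q) if in_top q then map_poly polyC (Mt i (exchange_col q)) else 0.
Definition bottom_mx : 'M[{poly {poly K}}]_(p, p + p) :=
  \matrix_(i, q) if in_bottom q then (Mt i (exchange_col q))%:P else 0.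

Lemma split_l (j : 'I_p) : split (lshift p j) = inl j.
Proof. exact: (unsplitK (inl j)). Qed.
Lemma split_r (j : 'I_p) : split (rshift p j) = inr j.
Proof. exact: (unsplitK (inr j)). Qed.

(** There are p + 1 + (y.2 - x.2) exchanged columns, and at most p of them are
    used by the top rows. *)
Lemma card_exchange (s : 'S_(p + p)) :
  (y.2 - x.2 < \sum_i (in_top (s (rshift p i)) && in_bottom (s (rshift p i))))%N.
Proof.
pose b q := in_top q && in_bottom q.
have : (\sum_q b q = (p - i0) + j0.+1)%N.
  rewrite big_split_ord /= -sum_ord_ge; congr (_ + _)%N.
    by apply: eq_bigr => j _; rewrite /b /in_top /in_bottom split_l.
  rewrite (eq_bigr (fun j : 'I_p => (j <= j0)%N : nat)) => [|j _]; last first.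
    by rewrite /b /in_top /in_bottom split_r andbT.
  have : (\sum_(i < p) (i <= j0) + \sum_(i < p) (j0 < i) = p)%N.
    rewrite -big_split /= (eq_bigr (fun=> 1%N)) ?sum_nat_const ?card_ord ?muln1 // => i _.
    by case: leqP.
  rewrite sum_ord_ge; move: (\sum_(i < p) _)%N => a; have := ltn_ord j0; lia.
rewrite (reindex_inj (@perm_inj _ s)) /= big_split_ord /=.
have : (\sum_(i < p) b (s (lshift p i)) <= p)%N.
  by rewrite -[X in (_ <= X)%N]card_ord -sum1_card; apply: leq_sum => i _; exact: leq_b1.
rewrite /b ej0; move: (\sum_(i < p) _)%N (\sum_(i < p) _)%N => a c.
by have := ltn_ord i0; move: (y.2 - x.2)%N => e; lia.
Qed.

(** Subtracting the top rows from the bottom rows makes every bottom entry in an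
    exchanged column divisible by t - s, and every term of the determinant uses
    more than y.2 - x.2 such entries. *)
Lemma det_exchange : exists H, \det (col_mx top_mx bottom_mx) =
  var_diff K ^+ (y.2 - x.2).+1 * H.
Proof.
have -> : \det (col_mx top_mx bottom_mx) = \det (col_mx top_mx (bottom_mx - top_mx)).
  have -> : col_mx top_mx bottom_mx =
      block_mx 1%:M 0 1%:M 1%:M *m col_mx top_mx (bottom_mx - top_mx).
    by rewrite mul_block_col !mul1mx mul0mx addr0 addrC subrK.
  by rewrite det_mulmx det_lblock !det1 !mul1r.
have [Q eQ] : exists Q : 'I_p * 'I_(m + p) -> {poly {poly K}}, forall ij,
    (Mt ij.1 ij.2)%:P - map_poly polyC (Mt ij.1 ij.2) = var_diff K * Q ij.
  have /fin_all_exists[Q hQ] : forall ij : 'I_p * 'I_(m + p), exists q,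
     (Mt ij.1 ij.2)%:P - map_poly polyC (Mt ij.1 ij.2) = var_diff K * q.
    by move=> ij; apply: var_diff_dvd.
  by exists Q.
rewrite det_col_mx.
apply: (big_ind (fun G => exists H, G = var_diff K ^+ (y.2 - x.2).+1 * H)).
- by exists 0; rewrite mulr0.
- by move=> _ _ [G ->] [H ->]; exists (G + H); rewrite mulrDr.
move=> s _.
pose b i := in_top (s (rshift p i)) && in_bottom (s (rshift p i)).
have e i : (bottom_mx - top_mx) i (s (rshift p i)) = var_diff K ^+ b i *
    (if b i then Q (i, exchange_col (s (rshift p i))) else (bottom_mx - top_mx) i (s (rshift p i))).
  rewrite /b; case: ifP => [/andP[tb bb]|_]; last by rewrite expr0 mul1r.
  rewrite mxE [bottom_mx _ _]mxE bb [(- top_mx) _ _]mxE [top_mx _ _]mxE tb.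
  by rewrite (eQ (i, _)) expr1.
under [X in _ * (_ * X)]eq_bigr => i _ do rewrite e.
rewrite big_split /= prodrXr -(subnK (card_exchange s)) exprD.
have mulrCA5 (R : comNzRingType) (a g d f g' : R) :
  a * (g * (d * f * g')) = f * (a * (g * (d * g'))) by ring.
by rewrite mulrCA5; exists ((-1) ^+ s * (\prod_i top_mx i (s (lshift p i)) *
  (var_diff K ^+ (\sum_i b i - (y.2 - x.2).+1) *
  \prod_i (if b i then Q (i, exchange_col (s (rshift p i)))
    else (bottom_mx - top_mx) i (s (rshift p i)))))).
Qed.

Definition coef2 (G : {poly {poly K}}) a b : K := (G`_a)`_b.

Lemma coef2_tensor (P Q : {poly K}) a b : coef2 (map_poly polyC P * Q%:P) a b = P`_a * Q`_b.
Proof. by rewrite /coef2 coefMC coef_map coefCM. Qed.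

Lemma coef2_sign (b : bool) G i j : coef2 ((-1) ^+ b * G) i j = (-1) ^+ b * coef2 G i j.
Proof.
rewrite /coef2 -(rmorph_sign polyC) /= coefCM -(rmorph_sign polyC) /= coefCM.
by [].
Qed.

Lemma exchange_term (s : 'S_(p + p)) :
  laplace_term top_mx bottom_mx (top_set s) = 0 \/
  [/\ forall i, in_top (s (lshift p i)), forall i, in_bottom (s (rshift p i)) &
    laplace_term top_mx bottom_mx (top_set s) = (-1) ^+ s *
     (map_poly polyC (minor k n (fun i => exchange_col (s (lshift p i)))) *
      (minor k n (fun i => exchange_col (s (rshift p i))))%:P)].
Proof.
rewrite laplace_term_top.
case: (boolP [forall i, in_top (s (lshift p i))]) => [/forallP h1|]; last first.
  rewrite negb_forall => /existsP[i ni]; left.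
  by rewrite (@det_col0 _ _ _ i) ?mul0r ?mulr0 // => j; rewrite !mxE /= (negPf ni).
case: (boolP [forall i, in_bottom (s (rshift p i))]) => [/forallP h2|]; last first.
  rewrite negb_forall => /existsP[i ni]; left.
  by rewrite [X in _ * (_ * X)](@det_col0 _ _ _ i) ?mulr0 // => j; rewrite !mxE /= (negPf ni).
right; split=> //; congr (_ * (_ * _)); rewrite /minor.
  rewrite -det_map_mx; congr (\det _); apply/matrixP=> i j.
  by rewrite !mxE /= h1.
rewrite -[RHS]det_map_mx; congr (\det _); apply/matrixP=> i j.
by rewrite !mxE /= h2.
Qed.

(** The exchanged columns of y are all smaller than those of x, so that any true
    exchange lowers the columns of the first factor. *)
Lemma exchange_sum_lt (s : 'S_(p + p)) :
  (forall i, in_top (s (lshift p i))) -> (forall i, in_bottom (s (rshift p i))) ->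
  top_set s != top_set 1 ->
  (\sum_i exchange_col (s (lshift p i)) < \sum_i cols x i)%N.
Proof.
move=> h1 h2 ns.
have sumE (r : 'S_(p + p)) :
    (\sum_i exchange_col (r (lshift p i)) = \sum_(q in top_set r) exchange_col q)%N.
  by rewrite /top_set big_imset //= => i j _ _ /perm_inj/lshift_inj.
have -> : (\sum_i cols x i = \sum_(q in top_set 1) exchange_col q)%N.
  by rewrite -sumE; apply: eq_bigr => i _; rewrite perm1 /exchange_col split_l.
rewrite sumE (big_setID (top_set 1)) /= [X in (_ < X)%N](big_setID (top_set s)) /=.
rewrite setIC ltn_add2l.
set A := top_set s :\: _; set B := top_set 1 :\: _.
have cardT (r : 'S_(p + p)) : #|top_set r| = p.
  by rewrite /top_set card_imset ?card_ord // => i j /perm_inj/lshift_inj.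
have cAB : #|A| = #|B|.
  by apply/eqP; rewrite -(eqn_add2l #|top_set s :&: top_set 1|) cardsID setIC cardsID !cardT.
have A0 : (0 < #|A|)%N.
  rewrite card_gt0; apply: contra ns; rewrite setD_eq0 => sub.
  by rewrite eqEcard sub !cardT leqnn.
have inA q : q \in A -> (exchange_col q < cols x i0)%N.
  rewrite inE => /andP[nq /imsetP[i _ eq]]; have := h1 i; rewrite -eq.
  rewrite /in_top /exchange_col; case: (split_ordP q) => j ej.
    move=> _; exfalso.
    by move: nq; rewrite ej => /imsetP[]; exists j; rewrite ?perm1.
  by move=> le; apply: leq_ltn_trans ltyx; apply: leq_cols.
have inB q : q \in B -> (cols x i0 <= exchange_col q)%N.
  rewrite inE => /andP[nq /imsetP[i _ eq]]; rewrite perm1 in eq.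
  have [r er] : exists r, q = s r by exists (s^-1%g q); rewrite permKV.
  move: nq er; case: (split_ordP r) => j -> nq er.
    by move: nq; rewrite er => /imsetP[]; exists j.
  have := h2 j; rewrite -er eq /in_bottom /exchange_col split_l; exact: leq_cols.
apply: (@leq_trans (\sum_(q in B) cols x i0)); last by apply: leq_sum => q /inB.
rewrite sum_nat_const -cAB -sum_nat_const.
have [q qA] : exists q, q \in A by apply/set0Pn; rewrite -card_gt0.
rewrite (bigD1 q) //= [X in (_ < X)%N](bigD1 q) //= -addSn leq_add ?inA //.
by apply: leq_sum => r /andP[/inA/ltnW].
Qed.

(** The columns are arranged such that the identity permutation yields the product
    of the two given minors, with sign 1. *)
Lemma exchange_term_id : laplace_term top_mx bottom_mx (top_set 1) =
  map_poly polyC (minor k n (cols x)) * (minor k n (cols y))%:P.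
Proof.
rewrite laplace_term_top odd_perm1 expr0 mul1r /minor -det_map_mx.
rewrite -[X in _ = _ * X](det_map_mx polyC).
have -> : colsub ((1%g : 'S__) \o @lshift p p) top_mx =
    map_mx (map_poly polyC) (colsub (cols x) Mt).
  by apply/matrixP=> i j; rewrite !mxE /= perm1 /in_top /exchange_col split_l.
have -> // : colsub ((1%g : 'S__) \o @rshift p p) bottom_mx = map_mx polyC (colsub (cols y) Mt).
by apply/matrixP=> i j; rewrite !mxE /= perm1 /in_bottom /exchange_col split_r.
Qed.

(** In the exchange relation, the annihilating form removes the bidegrees between
    that of the given product and its mirror image, the latter included.  What
    remains is more spread out, or has a smaller first factor. *)
Lemma straightening_step :
  (forall h h' a b, (a + b)%N = T ->
     [|| (a < x.2)%N, (b < x.2)%N | (a == x.2) && (\sum_i h i < \sum_i cols x i)%N] ->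
     quadratic_standard T ((minor k n h)`_a * (minor k n h')`_b)) ->
  quadratic_standard T (phi_gen k x * phi_gen k y).
Proof.
move=> IH; have [H eH] := det_exchange.
have [q [ann qc q0]] := annihilator K (y.2 - x.2) x.2.
have := ann T H; rewrite -eH laplace.
pose t a J := coef2 (laplace_term top_mx bottom_mx J) a (T - a) *~ q a.
have -> : \sum_(a < T.+1) ((\sum_J laplace_term top_mx bottom_mx J)`_a)`_(T - a) *~ q a =
    \sum_(a < T.+1) \sum_J t a J.
  by apply: eq_bigr => a _; rewrite !coef_sum mulrz_suml.
have lt : (x.2 < T.+1)%N by rewrite ltnS leq_addr.
have tstd (a : 'I_T.+1) J : (a != Ordinal lt) || (J != top_set 1) -> quadratic_standard T (t a J).
  move=> naJ; rewrite /t.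
  have [zq|ha] : q a = 0 \/ [|| a < x.2, T - a < x.2 | a == x.2 :> nat]%N.
    case: (ltngtP a x.2) => [la|la|ea]; [by right | | by right; rewrite !orbT].
    case: (leqP a y.2) => lay; last by right; have := ltn_ord a; lia.
    left; rewrite -(subnKC (ltnW la)) q0 // subn_gt0 la /=.
    exact: leq_sub2r.
  - by rewrite zq mulr0z; apply: quadratic_standard0.
  apply: quadratic_standard_int.
  case: (boolP [exists s, top_set s == J]) => [/existsP[s /eqP eJ]|]; last first.
    rewrite negb_exists => /forallP nJ; rewrite laplace_term_eq0 //.
    by rewrite /coef2 !coef0; apply: quadratic_standard0.
  rewrite -eJ in naJ *; have [->|[h1 h2 ->]] := exchange_term s.
    by rewrite /coef2 !coef0; apply: quadratic_standard0.
  rewrite coef2_sign coef2_tensor; apply: quadratic_standard_sign; apply: IH.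
    by rewrite subnKC // -ltnS.
  case/or3P: ha => [->|->|/eqP ea]; rewrite ?orbT //.
  rewrite ea eqxx (exchange_sum_lt h1 h2) ?orbT //.
  by move: naJ; rewrite -val_eqE /= ea eqxx.
rewrite (bigD1 (Ordinal lt)) //= (bigD1 (top_set 1)) //= -addrA => /eqP.
rewrite addr_eq0 => /eqP e.
have : quadratic_standard T (t x.2 (top_set 1)).
  rewrite e -mulN1r -[-1](expr1); apply: (@quadratic_standard_sign _ true); apply: quadratic_standardD.
    by apply: quadratic_standard_sum => J nJ; apply: (tstd (Ordinal lt)); rewrite nJ orbT.
  apply: quadratic_standard_sum => a na; apply: quadratic_standard_sum => J _.
  by apply: tstd; rewrite na.
rewrite /t qc exchange_term_id coef2_tensor addKn.
move/(@quadratic_standard_int T ((-1) ^+ (y.2 - x.2))); rewrite -mulrzA -expr2 sqrr_sign.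
by rewrite -!phi_minor.
Qed.

End Exchange.

(** Induction on the distance of the degrees, upwards, and then on the sum of the
    columns of the first factor; both are bounded. *)
Lemma straightening x y : quadratic_standard (x.2 + y.2) (phi_gen k x * phi_gen k y).
Proof.
wlog lexy : x y / (x.2 <= y.2)%N => [hw|].
  have /orP[/hw//|/hw] := leq_total x.2 y.2.
  by rewrite [in X in quadratic_standard X]addnC mulrC.
(* M exceeds every sum of columns, so that mu orders pairs lexicographically. *)
pose M := (p * (m + p)).+1.
pose mu x y := ((n * p - (y.2 - x.2)) * M + \sum_i cols x i)%N.
have sumM (z : symb) : (\sum_i cols z i < M)%N.
  rewrite ltnS; apply: (@leq_trans (\sum_(i < p) (m + p))%N); last first.
    by rewrite sum_nat_const card_ord.
  by apply: leq_sum => i _; apply: ltnW; apply: ltn_ord.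
have [N] := ubnP (mu x y); elim: N x y lexy => // N IH x y lexy ltN.
case: (boolP (symb_le x y)) => [|]; first exact: quadratic_standard_le.
rewrite negb_and lexy /= negb_forall => /existsP[i0]; rewrite negb_forall.
case/existsP=> j0; rewrite negb_imply -ltnNge => /andP[/eqP ej0 ltyx].
apply: (straightening_step lexy ej0 ltyx) => h h' a b eT hab.
have big c (g : 'I_p -> 'I_(m + p)) : (n * p < c)%N -> (minor k n g)`_c = 0.
  by move=> lt; apply: nth_default; apply: leq_trans lt; apply: size_minor.
case: (ltnP (n * p) a) => [/big->|la]; first by rewrite mul0r; apply: quadratic_standard0.
case: (ltnP (n * p) b) => [/big->|lb]; first by rewrite mulr0; apply: quadratic_standard0.
have [->|[al [s [-> sal]]]] := minor_sort k n h;
  first by rewrite coef0 mul0r; apply: quadratic_standard0.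
have [->|[be [s' [-> _]]]] := minor_sort k n h';
  first by rewrite coef0 mulr0; apply: quadratic_standard0.
rewrite !coef_signM -mulrA; apply: quadratic_standard_sign.
rewrite mulrCA; apply: quadratic_standard_sign.
pose X : symb := (al, Ordinal (la : (a < (n * p).+1)%N)).
pose Y : symb := (be, Ordinal (lb : (b < (n * p).+1)%N)).
have spread x' y' : (y.2 - x.2 < y'.2 - x'.2)%N -> (mu x' y' < mu x y)%N.
  move=> lt; have := sumM x'; rewrite /mu; have ly : (y'.2 <= n * p)%N by rewrite -ltnS.
  have : ((n * p - (y'.2 - x'.2)).+1 * M <= (n * p - (y.2 - x.2)) * M)%N.
    rewrite leq_mul2r; apply/orP; right; move: lt ly.
    move: (n * p)%N (y.2 - x.2)%N (nat_of_ord y'.2) (nat_of_ord x'.2) => c d e f; lia.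
  rewrite mulSn; move: (_ * M)%N (_ * M)%N (\sum_(i < p) _)%N (\sum_(i < p) _)%N => c d e f.
  lia.
case: (leqP a b) => ab.
  rewrite -eT; apply: (IH X Y) => //; rewrite -ltnS; apply: leq_trans ltN; rewrite ltnS.
  case: (ltnP a x.2) => lax.
    apply: spread; rewrite /X /Y /=; move: lax eT lexy.
    move: (nat_of_ord x.2) (nat_of_ord y.2) => c d; lia.
  move: hab; rewrite (leq_gtF lax) (leq_gtF (leq_trans lax ab)) /= => /andP[/eqP ea ls].
  have eb : b = y.2 by move: eT; rewrite ea => /addnI.
  rewrite /mu /X /Y /= (_ : (b - a = y.2 - x.2)%N); last by rewrite ea eb.
  by rewrite ltn_add2l; move: ls; rewrite -sal.
rewrite -eT addnC mulrC; apply: (IH Y X); first exact: ltnW.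
rewrite -ltnS; apply: leq_trans ltN; rewrite ltnS; apply: spread; rewrite /X /Y /=.
have bx : (b < x.2)%N.
  rewrite ltnNge; apply/negP=> xb; move: hab; rewrite (leq_gtF xb) (leq_gtF (leq_trans xb (ltnW ab))).
  case/andP=> /eqP ea _; move: ab xb; rewrite ea; lia.
move: bx eT lexy ab; move: (nat_of_ord x.2) (nat_of_ord y.2) => c d; lia.
Qed.

End Straightening.

(** * The weight of a pair of symbols *)

Section Weight.
Variables (k : fieldType) (p m n : nat).
Local Notation symb := (symb p m n).
Implicit Types (x y : symb) (u v : fmon symb).
Local Notation pair x y := (U_(enum_rank x) + U_(enum_rank y))%MM.

Lemma mass_pair d x y : mass d (pair x y) = (d x + d y)%N :> nat.
Proof. by rewrite massD !massU. Qed.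

Definition cyc_sign : k := (-1) ^+ perm (@ordS_inj p).

(** Raising the degree by 1 rotates the rows once more.  Hence the signs of a
    product of generators depend on its total degree only. *)
Lemma phi_signE x : phi_sign k x = cyc_sign ^+ x.2.
Proof.
rewrite /phi_sign /rotation odd_permV /cyc_sign.
have -> : perm (@residue_inj p n x.2) = (perm (@ordS_inj p) ^+ x.2)%g.
  apply/permP=> r; apply: val_inj; rewrite permE /=.
  elim: (nat_of_ord x.2) => [|a IH]; first by rewrite expg0 perm1 add0n modn_small.
  by rewrite expgSr permM permE /= -IH -[in RHS]addn1 modnDml addn1 addSn.
elim: (nat_of_ord x.2) => [|a IH]; first by rewrite expg0 odd_perm1.
by rewrite expgSr odd_permM signr_addb IH exprSr.
Qed.

Lemma cyc_sign_neq0 : cyc_sign != 0.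
Proof. by rewrite signr_eq0. Qed.

Lemma window_sum_square a : (window_sum p square a =
  p * (a * a) + 2 * a * (\sum_(r < p) r) + \sum_(r < p) r * r)%N.
Proof.
rewrite /window_sum -[p in (p * _)%N]card_ord -sum_nat_const big_distrr /= -!big_split /=.
by apply: eq_bigr => r _; rewrite /square; lia.
Qed.

Lemma sum_delta (T : finType) (V : zmodType) (F : T -> V) t t' :
  \sum_z F z *+ ((t == z) + (t' == z)) = F t + F t'.
Proof.
under eq_bigr do rewrite mulrnDr.
have delta a : \sum_z F z *+ (a == z) = F a.
  rewrite (bigD1 a) //= eqxx big1 ?addr0 // => z.
  by rewrite eq_sym => /negPf ->.
by rewrite big_split !delta.
Qed.

Lemma weight_pair x y : weight (pair x y) = - ((x.2 * x.2 + y.2 * y.2)%N%:Z).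
Proof.
transitivity (- ((x.2 : nat)%:Z ^+ 2) - (y.2 : nat)%:Z ^+ 2); last first.
  move: (nat_of_ord x.2) (nat_of_ord y.2) => a b.
  by rewrite PoszD !PoszM opprD.
rewrite -(sum_delta (fun z : symb => - ((z.2 : nat)%:Z ^+ 2)) x y).
by apply: eq_bigr => z _; rewrite expoD !expoU.
Qed.

(** Both are affine functions of the sum of the squares of the two degrees, with
    slopes of opposite signs, once the sum of the degrees is given. *)
Lemma weight_mass x y x' y' : (0 < p)%N -> (x.2 + y.2 = x'.2 + y'.2)%N ->
  (weight (pair x y) <= weight (pair x' y')) =
  (mass (fun x => window_sum p square x.2) (pair x' y') <=
   mass (fun x => window_sum p square x.2) (pair x y))%N.
Proof.
move=> p0 eT; rewrite !weight_pair !mass_pair !window_sum_square lerN2 lez_nat.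
move: eT; move: (nat_of_ord x.2) (nat_of_ord y.2) (nat_of_ord x'.2) (nat_of_ord y'.2) => a b c d eT.
set s := (\sum_(r < p) r)%N; set t := (\sum_(r < p) r * r)%N.
have e a' b' : (p * (a' * a') + 2 * a' * s + t + (p * (b' * b') + 2 * b' * s + t) =
   p * (a' * a' + b' * b') + (2 * (a' + b') * s + 2 * t))%N by lia.
by rewrite !e eT leq_add2r leq_pmul2l.
Qed.

Lemma mcoeff_filter (f : {fpoly k[symb]}) (P : pred (fmon symb)) u :
  (\sum_(v <- msupp f | P v) f@_v *: 'X_[v])@_u = if P u then f@_u else 0.
Proof.
rewrite -big_filter raddf_sum /=.
under eq_bigr => v _ do rewrite mcoeffZ mcoeffX.
case: (boolP (u \in [seq v <- msupp f | P v])) => uf.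
  rewrite (bigD1_seq u) ?filter_uniq ?msupp_uniq //= eqxx mulr1.
  rewrite big1 ?addr0 => [|v nv]; last by rewrite (negPf nv) mulr0.
  by move: uf; rewrite mem_filter => /andP[->].
rewrite big_seq big1 => [|v vf]; last first.
  by case: eqP => [e|_]; rewrite ?mulr0 //; rewrite -e vf in uf.
move: uf; rewrite mem_filter negb_and => /orP[/negPf->//|].
by rewrite -mcoeff_eq0 => /eqP ->; rewrite if_same.
Qed.

End Weight.

(** * The relations of the incomparable pairs *)

Section Final.
Variables (k : fieldType) (p m n : nat).
Local Notation symb := (symb p m n).
Variable lin : rel symb.
Hypotheses (p_gt0 : (0 < p)%N) (lin_ext : linear_extension lin).
Implicit Types (x y : symb) (u v : fmon symb) (f g : {fpoly k[symb]}).
Local Notation pair x y := (U_(enum_rank x) + U_(enum_rank y))%MM.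
Local Notation std := (standard (@incomparable p m n)).

Lemma mdeg_pair x y : mdeg (pair x y) = 2.
Proof. by rewrite mdegD !mdeg1. Qed.

Lemma standard_pair x y : symb_le x y -> std (pair x y).
Proof.
move=> le; apply/standardP=> a b ab; apply/negP=> h.
have e : pair a b = pair x y by apply: lepm_mdeg_eq h _; rewrite !mdeg_pair.
have ex z : (expo (pair a b) z != 0%N) -> (z == x) || (z == y).
  by rewrite e expoD !expoU; rewrite ![z == _]eq_sym; do 2!case: (_ == z).
have /ex ha : expo (pair a b) a != 0%N by rewrite expoD !expoU eqxx.
have /ex hb : expo (pair a b) b != 0%N by rewrite expoD !expoU eqxx addn1.
move: ab; rewrite /incomparable.
move: ha hb (congr1 (fun u => expo u y) e); rewrite !expoD !expoU eqxx.
case: (eqVneq a x) => [->|_]; case: (eqVneq b x) => [->|_] /=.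
- by rewrite symb_le_refl.
- by move=> _ /eqP ->; rewrite le.
- by move=> /eqP -> _; rewrite le andbF.
by move=> /eqP -> /eqP ->; rewrite symb_le_refl.
Qed.

Lemma nstandard_pair x y : incomparable x y -> ~~ std (pair x y).
Proof. by move=> inc; apply/nstandardP; exists x, y; split=> //; apply: lepm_refl. Qed.

Lemma ker_phi_nonstandard N z s f : phi f = 0 -> f != 0 ->
  exists2 u, u \in msupp f /\ ~~ std u &
    forall v, v \in msupp f ->
      (mass (chain_mass N z s) u <= mass (@chain_mass p m n N z s) v)%N.
Proof.
apply: (kernel_nonstandard p_gt0 lin_ext (phi_lead_chain k N z s)) => x.
by rewrite mulf_neq0 // signr_eq0.
Qed.

Lemma ker_phi_standard f : ker_phi f -> (forall u, u \in msupp f -> std u) -> f = 0.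
Proof.
move=> ff hf; apply/eqP/idPn => nf.
by have [u [uf /negP[]]] := ker_phi_nonstandard 0 0 0 ff nf; apply: hf.
Qed.

Lemma ker_chi_standard f : ker_chi f -> (forall u, u \in msupp f -> std u) -> f = 0.
Proof.
move=> ff hf; apply/eqP/idPn => nf.
have c0 (x : symb) : antidiagonal_sign k p != 0 by rewrite signr_eq0.
have [u [uf /negP[]]] := kernel_nonstandard p_gt0 lin_ext (chi_lead k 0 0 0) c0 ff nf.
exact: hf.
Qed.

(** The properties of S(x, y) that do not involve the linear extension. *)
Definition plucker_relation x y f : Prop :=
  [/\ ker_phi f, f@_(pair x y) = 1 &
    forall u, u \in msupp f -> u != pair x y -> exists a b,
      [/\ u = pair a b, symb_le a b, (a.2 + b.2 = x.2 + y.2)%N, symb_le a x & symb_le a y]].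

(** Existence is [straightening].  For the bounds a <= x and a <= y, the pair
    itself is the only monomial of f that is not standard, so it has the least mass
    for all weights; for N large this compares hinges.  With z one more than the
    level of x or y at s, a hinge of the pair is positive, hence so is one of a or
    b, and a has the smaller level. *)
Lemma plucker_relation_exists x y : incomparable x y -> exists f, plucker_relation x y f.
Proof.
move=> inc; have [g [eg hg]] := straightening k x y.
have ng : pair x y \notin msupp g.
  apply: contra (nstandard_pair inc) => /hg[a [b [-> le _]]]; exact: standard_pair.
pose f := 'X_[pair x y] - g.
have f1 : f@_(pair x y) = 1.
  by rewrite mcoeffB mcoeffX eqxx (memN_msupp_eq0 ng) subr0.
have f0 : ker_phi f.
  rewrite /ker_phi /phi alg_mapB mpolyXD alg_mapM !alg_mapU.
  by move: eg; rewrite /phi => ->; rewrite subrr.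
have fg u : u \in msupp f -> u != pair x y -> u \in msupp g.
  move=> /msuppB_le; rewrite mem_cat msuppX inE => /orP[/eqP->|//].
  by rewrite eqxx.
exists f; split=> // u uf nu; have [a [b [eu le eT]]] := hg u (fg u uf nu).
suff [ax ay] : symb_le a x /\ symb_le a y by exists a, b; split.
have nf : f != 0 by apply: contraTneq uf => ->; rewrite msupp0.
have hinge_le z s : (window_sum p (hinge z) (level x s) + window_sum p (hinge z) (level y s) <=
    window_sum p (hinge z) (level a s) + window_sum p (hinge z) (level b s))%N.
  rewrite leqNgt; apply/negP=> lt.
  (* With this N a single unit of hinge outweighs all squares of u. *)
  pose N := (mass (@chain_mass p m n 0 z s) u).+1.
  have [v [vf nv] minv] := ker_phi_nonstandard N z s f0 nf.
  have ev : v = pair x y.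
    apply/eqP/idPn => nvxy; have [a' [b' [ev le' _]]] := hg v (fg v vf nvxy).
    by move: nv; rewrite ev standard_pair.
  have := minv u uf; rewrite ev; apply/negP; rewrite -ltnNge.
  rewrite eu !mass_pair /N eu mass_pair /chain_mass !mul0n !addn0.
  move: lt; move: (window_sum p (hinge z) (level a s)) (window_sum p (hinge z) (level b s)) => c d.
  move: (window_sum p (hinge z) (level x s)) (window_sum p (hinge z) (level y s)) => c' d'.
  move: (\sum_(t < _) _)%N (\sum_(t < _) _)%N (\sum_(t < _) _)%N (\sum_(t < _) _)%N => A B C D.
  have [M eM] : exists M, M = (D + C).+1 by exists (D + C).+1.
  rewrite -eM => lt; have : ((c + d).+1 * M <= (c' + d') * M)%N by rewrite leq_mul2r lt orbT.
  by rewrite mulSn !mulnDl ![(M * _)%N]mulnC eM; clear; lia.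
have lev s : (level a s <= level b s)%N by have /symb_le_level := le.
have key z s : (level x s < z)%N || (level y s < z)%N -> (level a s < z)%N.
  move=> h; rewrite ltnNge; apply/negP=> za.
  have w0 c : (z <= level c s)%N -> window_sum p (hinge z) (level (c : symb) s) = 0%N.
    by move=> zc; apply/eqP; rewrite -leqn0 leqNgt hinge_gt0 // ltnNge zc.
  have := hinge_le z s; rewrite (w0 a za) (w0 b (leq_trans za (lev s))) leqn0 addn_eq0.
  case/andP=> /eqP wx /eqP wy; move: h.
  by rewrite -(hinge_gt0 p_gt0 z (level x s)) -(hinge_gt0 p_gt0 z (level y s)) wx wy.
by split; apply/symb_le_level=> s; rewrite -ltnS; apply: key; rewrite ltnSn ?orbT.
Qed.

(** In every linear extension a precedes x, y and b, so that a is the smallest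
    variable at which the two monomials differ. *)
Lemma plucker_tail x y f u : incomparable x y -> plucker_relation x y f ->
  u \in msupp f -> u != pair x y -> std u /\ drl_lt lin u (pair x y).
Proof.
case: lin_ext => _ anti tr tot ext.
move=> /andP[nxy nyx] [_ _ hf] uf nu; have [a [b [eu le eT ax ay]]] := hf u uf nu.
split; first by rewrite eu standard_pair.
have nax : a != x by apply: contraNneq nxy => <-.
have nay : a != y by apply: contraNneq nyx => <-.
apply/drl_ltP; right; rewrite eu !mdeg_pair; split=> //.
exists a => [|z za nz]; rewrite !expoD !expoU.
  by rewrite ![_ == a]eq_sym (negPf nax) (negPf nay) eqxx.
have F c : symb_le a c -> a != c -> c == z = false.
  move=> ac nac; apply/negbTE; apply: contraNneq nac => ec.
  by rewrite (anti a c) // ext //= ec.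
rewrite (F x ax nax) (F y ay nay) [a == z]eq_sym (negPf nz) add0n.
case: (eqVneq a b) => [<-|nab]; last by rewrite (F b le nab).
by rewrite eq_sym (negPf nz).
Qed.

(** The relations found above form a reduced basis, and such a basis is unique:
    the description of S(x, y) therefore picks one of them. *)
Lemma Spol_plucker x y : incomparable x y -> plucker_relation x y (Spol k lin x y).
Proof.
case: (lin_ext) => _ anti tr tot _.
pose S x y := epsilon (inhabits 0) (plucker_relation x y).
have SP a b : incomparable a b -> plucker_relation a b (S a b).
  by move=> /plucker_relation_exists; apply: epsilon_spec.
have I0 : ker_phi (0 : {fpoly k[symb]}) by exact: alg_map0.
have ID f g : ker_phi f -> ker_phi g -> ker_phi (f + g).
  by rewrite /ker_phi /phi alg_mapD => -> ->; rewrite addr0.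
have IM f g : ker_phi g -> ker_phi (f * g).
  by rewrite /ker_phi /phi alg_mapM => ->; rewrite mulr0.
have Sin a b : incomparable a b -> ker_phi (S a b) by move=> /SP[].
have Slead a b : incomparable a b -> (S a b)@_(pair a b) = 1 by move=> /SP[].
have Stail a b u : incomparable a b -> u \in msupp (S a b) -> u != pair a b ->
    std u /\ drl_lt lin u (pair a b).
  by move=> ab; apply: plucker_tail ab (SP a b ab).
move=> inc; have [G Gred [fG ef]] : exists2 G, reduced_groebner lin (@ker_phi k p m n) G &
    Spol k lin x y \in G /\ inmon lin (Spol k lin x y) = pair x y.
  apply: (epsilon_spec (inhabits 0) (fun f => exists2 G,
    reduced_groebner lin (@ker_phi k p m n) G & f \in G /\ inmon lin f = pair x y)).
  exists (S x y), [seq S x.1 x.2 | x : symb * symb in [pred x | incomparable x.1 x.2]].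
    exact: (reduced_groebner_standard anti tr tot I0 ID IM Sin Slead Stail ker_phi_standard).
  split; first by apply/imageP; exists (x, y).
  exact: (S_inmon anti tr tot Slead Stail inc).
rewrite (reduced_groebner_unique anti tr tot ID IM Sin Slead Stail ker_phi_standard Gred fG inc ef).
exact: SP.
Qed.

(** The terms of maximal weight are those of least mass for the squares of the
    rows, for which the initial form of phi(x) is chi(x) up to sign. *)
Lemma in_w_plucker x y f : plucker_relation x y f ->
  ker_chi (in_w f) /\ exists P : pred (fmon symb),
    (exists2 u, u \in msupp f & P u) /\ forall u, (in_w f)@_u = if P u then f@_u else 0.
Proof.
case=> f0 f1 hf; pose ms := mass (fun x : symb => window_sum p square x.2).
have hp u : u \in msupp f -> exists a b, u = pair a b /\ (a.2 + b.2 = x.2 + y.2)%N.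
  case: (eqVneq u (pair x y)) => [-> _|nu uf]; first by exists x, y.
  by have [a [b [-> _ e _ _]]] := hf u uf nu; exists a, b.
have nf : msupp f != [::].
  by rewrite msupp_eq0; apply: contra_eq_neq f1 => ->; rewrite mcoeff0 eq_sym oner_eq0.
have [u0 u0f minu] := exists_min ms nf.
have wE u : u \in msupp f -> all (fun v => weight v <= weight u) (msupp f) = (ms u == ms u0).
  move=> uf; have cmp v : v \in msupp f -> (weight v <= weight u) = (ms u <= ms v)%N.
    move=> /hp[a [b [-> eab]]]; have [c [d [-> ecd]]] := hp u uf.
    by apply: weight_mass; rewrite ?eab.
  apply/allP/eqP => [h|e v vf]; last by rewrite cmp // e minu.
  by apply/anti_leq; rewrite minu // -cmp // h.
have eW : in_w f = \sum_(u <- msupp f | ms u == ms u0) f@_u *: 'X_[u].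
  rewrite /in_w big_seq_cond [RHS]big_seq_cond; apply: eq_bigl => u.
  by case: (boolP (u \in msupp f)) => //= uf; rewrite wE.
split; last first.
  exists (fun u => ms u == ms u0); split; first by exists u0.
  by move=> u; rewrite eW mcoeff_filter.
have := initial_form_relation (phi_lead_square k (n:=n)) f0 minu => rel.
have : cyc_sign k p ^+ (x.2 + y.2) *: chi (in_w f) = 0.
  rewrite eW /chi alg_map_sum scaler_sumr -[RHS]rel [LHS]big_seq_cond [RHS]big_seq_cond.
  apply: eq_bigr => u /andP[/hp[a [b [-> eab]]] _].
  rewrite alg_mapZ scalerA mulrC -scalerA; congr (_ *: _).
  rewrite mpolyXD !alg_mapM !alg_mapU -eab !phi_signE.
  by rewrite -scalerAl -scalerAr scalerA -exprD.
by move/eqP; rewrite scaler_eq0 expf_eq0 (negPf (cyc_sign_neq0 k p)) andbF => /eqP.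
Qed.

(** Without x * y, the terms of maximal weight would be a nonzero combination of
    standard monomials in the kernel of chi. *)
Lemma Rpol_relation x y : incomparable x y ->
  [/\ ker_chi (Rpol k lin x y), (Rpol k lin x y)@_(pair x y) = 1 &
    {subset msupp (Rpol k lin x y) <= msupp (Spol k lin x y)}].
Proof.
move=> inc; have SP := Spol_plucker inc; rewrite /Rpol.
have [R0 [P [[u0 u0S Pu0] eR]]] := in_w_plucker SP.
have sub : {subset msupp (in_w (Spol k lin x y)) <= msupp (Spol k lin x y)}.
  by move=> u; rewrite !mcoeff_msupp eR; case: ifP; rewrite ?eqxx.
case: SP => _ S1 hS; split=> //; rewrite eR S1; case: ifP => // /negP[].
apply/idPn => nP; have : in_w (Spol k lin x y) = 0.
  apply: ker_chi_standard R0 _ => u; rewrite mcoeff_msupp eR.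
  case: ifP => [Pu|_]; last by rewrite eqxx.
  rewrite -mcoeff_msupp => uS.
  have nu : u != pair x y by apply: contraNneq nP => <-.
  by have [a [b [-> le _ _ _]]] := hS u uS nu; apply: standard_pair.
move/(congr1 (mcoeff u0)); rewrite eR Pu0 mcoeff0 => /eqP.
by rewrite mcoeff_eq0 u0S.
Qed.

End Final.

Theorem corollary18 (k : fieldType) (p m n : nat)
    (p_gt0 : (0 < p)%N) (m_gt0 : (0 < m)%N)
    (lin : rel (symb p m n)) (lin_ext : linear_extension lin) :
  reduced_groebner lin (@ker_chi k p m n)
    [seq Rpol k lin x.1 x.2
    | x : symb p m n * symb p m n in [pred x | incomparable x.1 x.2]]
  /\ (forall x y : symb p m n, incomparable x y ->
        Rpol k lin x y \is 2.-homog).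
Proof.
have RP x y := @Rpol_relation k p m n lin p_gt0 lin_ext x y.
have Rtail x y u : incomparable x y -> u \in msupp (Rpol k lin x y) ->
    u != (U_(enum_rank x) + U_(enum_rank y))%MM ->
    standard (@incomparable p m n) u /\
      drl_lt lin u (U_(enum_rank x) + U_(enum_rank y))%MM.
  move=> inc uR; have [_ _ sub] := RP x y inc.
  exact: (plucker_tail lin_ext inc (Spol_plucker k p_gt0 lin_ext inc) (sub u uR)).
case: (lin_ext) => _ anti tr tot _; split.
  apply: (reduced_groebner_standard anti tr tot) => //.
  - exact: alg_map0.
  - by move=> f g; rewrite /ker_chi /chi alg_mapD => -> ->; rewrite addr0.
  - by move=> f g; rewrite /ker_chi /chi alg_mapM => ->; rewrite mulr0.
  - by move=> x y /RP[].
  - by move=> x y /RP[].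
  - exact: ker_chi_standard p_gt0 lin_ext.
move=> x y inc; apply/dhomogP => u uR; have [_ _ sub] := RP x y inc.
case: (eqVneq u (U_(enum_rank x) + U_(enum_rank y))%MM) => [->|nu].
  exact: mdeg_pair.
have [_ _ hS] := Spol_plucker k p_gt0 lin_ext inc.
by have [a [b [-> _ _ _ _]]] := hS u (sub u uR) nu; apply: mdeg_pair.
Qed.
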